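(* Let $F:\mathcal{K}\to\mathbb{R}$ be convex, suppose $\|\nabla f(w;z)\|\le G$ for all $w\in\mathcal{K}$, $z\in\Omega$, and suppose $\mathcal{K}$ has diameter at most $D$, i.e. $\sup_{x,y\in\mathcal{K}}\|x-y\|\le D$. Let $w^*$ be a minimizer of $F$ over $\mathcal{K}$. Then the output $\bar w_T$ of the MAG algorithm run for $T$ iterations with $\alpha=D/\sqrt{2}$ satisfies \[ \mathbb{E}[F(\bar w_T)-F(w^* )]\le \tilde{\mathcal{O}}\Big(GD\sqrt{\tfrac{\tau_{\mathrm{mix}}}{T}}\Big). \]
   Context: Let $\Omega$ be a finite set and $(z_k)_{k\ge1}$ an ergodic time-homogeneous Markov chain on $\Omega$ (arbitrary initial distribution) with stationary distribution $\mu$. For probability measures $P,Q$ on $\Omega$, $\|P-Q\|_{TV}=\sup_{A}|P(A)-Q(A)|$. Let $P^s(z,\cdot)$ denote the law of $z_{s+1}$ given $z_1=z$, $d_{\mathrm{mix}}(s)=\sup_{z\in\Omega}\|P^s(z,\cdot)-\mu\|_{TV}$, and $\tau_{\mathrm{mix}}=\inf\{s:d_{\mathrm{mix}}(s)\le 1/4\}$. $\mathcal{K}\subseteq\mathbb{R}^d$ is a closed convex set, $f(\cdot;z)$ is differentiable for each $z$, and $F(w)=\mathbb{E}_{z\sim\mu}[f(w;z)]$. MAG algorithm (inputs $T\in\mathbb{N}$, $\alpha>0$, $w_1\in\mathcal{K}$): for $t=1,\dots,T$: draw $J_t$ with $\mathbb{P}(J_t=j)=2^{-j}$, $j\ge1$,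 independently of the chain and of previous draws; set $N_t=2^{J_t}$; iteration $t$ uses the next $N_t$ samples of the chain, denoted $z_t^{(i)}=z_{S_{t-1}+i}$ with $S_{t-1}=N_1+\dots+N_{t-1}$; for $j\ge0$ let $g_t^j=2^{-j}\sum_{i=1}^{2^j}\nabla f(w_t;z_t^{(i)})$; set $g_t=g_t^0+2^{J_t}(g_t^{J_t}-g_t^{J_t-1})$ if $2^{J_t}\le T$ and $g_t=g_t^0$ otherwise; set $\eta_t=\alpha/\sqrt{\sum_{k=1}^t\|g_k\|^2}$ and $w_{t+1}=\Pi_{\mathcal{K}}(w_t-\eta_t g_t)$ (Euclidean projection). Output $\bar w_T=\frac1T\sum_{t=1}^T w_t$. The notation $\tilde{\mathcal{O}}(X)$ means a quantity bounded by $c\cdot X$ times a factor polylogarithmic in $T$ and $\tau_{\mathrm{mix}}$, with $c$ an absolute constant. *)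

(* Defs.v *)
From HB Require Import structures.
From mathcomp Require Import all_boot all_order all_algebra.
From mathcomp Require Import all_classical all_reals all_analysis.
Set Implicit Arguments. Unset Strict Implicit. Unset Printing Implicit Defensive.
Import Order.TTheory GRing.Theory Num.Theory.
Import numFieldNormedType.Exports.
Local Open Scope classical_set_scope.
Local Open Scope ring_scope.

Section Defs.
Variable R : realType.

Definition enorm (d : nat) (v : 'rV[R]_d) : R := Num.sqrt (\sum_(i < d) v 0 i ^+ 2).

Definition convex_set_of (d : nat) (K : set 'rV[R]_d) : Prop :=
  forall x y l, K x -> K y -> 0 <= l <= 1 -> K (l *: x + (1 - l) *: y).

Definition convex_on (d : nat) (K : set 'rV[R]_d) (F : 'rV[R]_d -> R) : Prop :=
  forall x y l, K x -> K y -> 0 <= l <= 1 ->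
    F (l *: x + (1 - l) *: y) <= l * F x + (1 - l) * F y.

(* Euclidean projection onto K: a point of K at minimal Euclidean distance
   from x (unique when K is nonempty, closed and convex). *)
Definition proj (d : nat) (K : set 'rV[R]_d) (x : 'rV[R]_d) : 'rV[R]_d :=
  xget 0 [set y | K y /\ forall u, K u -> enorm (x - y) <= enorm (x - u)].

Definition grad (d : nat) (h : 'rV[R]_d -> R) (w : 'rV[R]_d) : 'rV[R]_d :=
  \row_(i < d) ('D_(delta_mx 0 i) h w).

Variable Omega : finType.

Definition is_distr (p : Omega -> R) : Prop :=
  (forall x, 0 <= p x) /\ \sum_x p x = 1.

Definition stochastic (P : Omega -> Omega -> R) : Prop :=
  forall x, is_distr (P x).

Fixpoint Pn (P : Omega -> Omega -> R) (n : nat) (x y : Omega) : R :=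
  match n with
  | 0 => (x == y)%:R
  | n'.+1 => \sum_u Pn P n' x u * P u y
  end.

Definition irreducible (P : Omega -> Omega -> R) : Prop :=
  forall x y, exists n, 0 < Pn P n x y.

Definition aperiodic (P : Omega -> Omega -> R) : Prop :=
  forall x, forall dv : nat, (1 < dv)%N ->
    ~ (forall n, (0 < n)%N -> 0 < Pn P n x x -> (dv %| n)%N).

Definition ergodic (P : Omega -> Omega -> R) : Prop :=
  stochastic P /\ irreducible P /\ aperiodic P.

Definition stationary (P : Omega -> Omega -> R) (mu : Omega -> R) : Prop :=
  is_distr mu /\ forall y, \sum_x mu x * P x y = mu y.

Definition tv (p q : Omega -> R) : R :=
  \big[Num.max/0]_(A : {set Omega}) `| \sum_(x in A) p x - \sum_(x in A) q x |.

Definition dmix (P : Omega -> Omega -> R) (mu : Omega -> R) (s : nat) : R :=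
  \big[Num.max/0]_(z : Omega) tv (Pn P s z) mu.

Definition is_tau_mix (P : Omega -> Omega -> R) (mu : Omega -> R) (tau : nat) : Prop :=
  dmix P mu tau <= 4^-1 /\ forall s, dmix P mu s <= 4^-1 -> (tau <= s)%N.

Fixpoint chain_prob (P : Omega -> Omega -> R) (x : Omega) (s : seq Omega) : R :=
  match s with
  | [::] => 1
  | y :: r => P x y * chain_prob P y r
  end.

Definition path_prob (nu : Omega -> R) (P : Omega -> Omega -> R) (s : seq Omega) : R :=
  match s with
  | [::] => 1
  | x :: r => nu x * chain_prob P x r
  end.

Variable d : nat.
Variable f : 'rV[R]_d -> Omega -> R.

Definition gavg (b : seq Omega) (w : 'rV[R]_d) (k : nat) : 'rV[R]_d :=
  (2 ^+ k)^-1 *: \sum_(x <- take (2 ^ k) b) grad (f^~ x) w.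

Definition mag_g (T : nat) (j : nat) (b : seq Omega) (w : 'rV[R]_d) : 'rV[R]_d :=
  if (2 ^ j <= T)%N then gavg b w 0 + (2 ^+ j) *: (gavg b w j - gavg b w j.-1)
  else gavg b w 0.

(* iterates [:: w_t; ...] given the remaining draws Js = J_t, ..., the remaining
   chain samples s, the current point w = w_t and acc = sum_{k<t} ||g_k||^2 *)
Fixpoint mag_iters (K : set 'rV[R]_d) (T : nat) (alpha : R)
    (Js : seq nat) (s : seq Omega) (w : 'rV[R]_d) (acc : R) : seq 'rV[R]_d :=
  match Js with
  | [::] => [::]
  | j :: Js' =>
      let b := take (2 ^ j) s in
      let g := mag_g T j b w in
      let acc' := acc + enorm g ^+ 2 in
      let eta := alpha / Num.sqrt acc' in
      w :: mag_iters K T alpha Js' (drop (2 ^ j) s) (proj K (w - eta *: g)) acc'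
  end.

Definition mag_output (K : set 'rV[R]_d) (T : nat) (alpha : R)
    (Js : seq nat) (s : seq Omega) (w1 : 'rV[R]_d) : 'rV[R]_d :=
  (T%:R)^-1 *: \sum_(w <- mag_iters K T alpha Js s w1 0) w.

Definition nsamples (Js : seq nat) : nat := (\sum_(j <- Js) 2 ^ j)%N.

Definition popF (mu : Omega -> R) (w : 'rV[R]_d) : R := \sum_z mu z * f w z.

(* E[ F(bar w_T) - F(wstar) ]: expectation over the i.i.d. draws J_1..J_T
   (P(J_t = j) = 2^{-j}, j >= 1) and the chain trajectory z_1..z_{S_T}. *)
Definition mag_expected_gap (K : set 'rV[R]_d) (T : nat) (alpha : R)
    (w1 : 'rV[R]_d) (nu mu : Omega -> R) (P : Omega -> Omega -> R)
    (wstar : 'rV[R]_d) : \bar R :=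
  (\esum_(J in [set J : T.-tuple nat | all (leq 1) J])
     ((\prod_(j <- J) (2 ^+ j)^-1) *
      \sum_(p : (nsamples J).-tuple Omega)
         path_prob nu P p * (popF mu (mag_output K T alpha J p w1) - popF mu wstar))%:E)%E.

End Defs.

(* Main.v *)
(** The expectation of the MAG estimator telescopes to that of the average over
    2^L consecutive samples, L = floor (log2 T). Correlations along the chain
    decay geometrically at scale tau, so an average over 2^k samples has
    mean-square error at most kappa / 2^k with kappa of order G^2 tau, whatever
    the state in which the block starts; hence the bias is of order
    G sqrt (tau / T), and the second moment of the estimator is of order
    kappa (1 + L), since level k contributes 2^-k * 4^k * kappa / 2^k.

    These two conditional bounds enter the AdaGrad analysis through the potential
    ((D^2 - |w - w*|^2) / (2 alpha) + alpha) sqrt (sum |g_k|^2), whose increments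
    dominate <g_t, w_t - w*>; Jensen's inequality for the square root is applied
    one iteration at a time, so that an induction on the number of remaining
    iterations carries the whole argument.

    The law of the draws is replaced by one supported on {0, ..., N}, which
    dominates 2^-j for 1 <= j <= N: the gap being nonnegative, a bound uniform in
    N bounds the infinite sum over the draws. *)
Require Import Defs.
From HB Require Import structures.
From mathcomp Require Import all_boot all_order all_algebra.
From mathcomp Require Import all_classical all_reals all_analysis.
From mathcomp Require Import ring lra.
Set Implicit Arguments.
Unset Strict Implicit.
Unset Printing Implicit Defensive.
Import Order.TTheory GRing.Theory Num.Theory.
Import numFieldNormedType.Exports.
Local Open Scope classical_set_scope.
Local Open Scope ring_scope.

(** * Euclidean geometry of row vectors: inner product, norm, Cauchy-Schwarz *)

Section Euclidean.
Variables (R : realType) (d : nat).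
Implicit Types u v w x y : 'rV[R]_d.

Definition dot u v : R := \sum_i u 0 i * v 0 i.

Lemma dotC u v : dot u v = dot v u.
Proof. by apply: eq_bigr => i _; rewrite mulrC. Qed.

Lemma dotDl u v w : dot (u + v) w = dot u w + dot v w.
Proof. by rewrite -big_split; apply: eq_bigr => i _; rewrite mxE mulrDl. Qed.

Lemma dotZl (a : R) u v : dot (a *: u) v = a * dot u v.
Proof. by rewrite mulr_sumr; apply: eq_bigr => i _; rewrite mxE mulrA. Qed.

Lemma dotNl u v : dot (- u) v = - dot u v.
Proof. by rewrite -scaleN1r dotZl mulN1r. Qed.

Lemma dotBl u v w : dot (u - v) w = dot u w - dot v w.
Proof. by rewrite dotDl dotNl. Qed.

Lemma dot0l v : dot 0 v = 0.
Proof. by rewrite -(scale0r 0) dotZl mul0r. Qed.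

Lemma dotDr u v w : dot u (v + w) = dot u v + dot u w.
Proof. by rewrite dotC dotDl !(dotC u). Qed.

Lemma dotZr (a : R) u v : dot u (a *: v) = a * dot u v.
Proof. by rewrite dotC dotZl dotC. Qed.

Lemma dotNr u v : dot u (- v) = - dot u v.
Proof. by rewrite dotC dotNl dotC. Qed.

Lemma dotBr u v w : dot u (v - w) = dot u v - dot u w.
Proof. by rewrite dotDr dotNr. Qed.

Lemma dot0r v : dot v 0 = 0.
Proof. by rewrite dotC dot0l. Qed.

Lemma dot_suml (I : Type) (r : seq I) (p : pred I) (F : I -> 'rV[R]_d) v :
  dot (\sum_(i <- r | p i) F i) v = \sum_(i <- r | p i) dot (F i) v.
Proof.
apply: (big_morph (dot^~ v)) => [u w|]; [exact: dotDl | exact: dot0l].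
Qed.

Lemma dot_ge0 v : 0 <= dot v v.
Proof. by apply: sumr_ge0 => i _; rewrite -expr2 sqr_ge0. Qed.

Lemma enormE v : enorm v ^+ 2 = dot v v.
Proof.
rewrite /enorm (_ : \sum_(i < d) v 0 i ^+ 2 = dot v v); last first.
  by apply: eq_bigr => i _; rewrite expr2.
by rewrite sqr_sqrtr ?dot_ge0.
Qed.

Lemma enorm_ge0 v : 0 <= enorm v.
Proof. exact: sqrtr_ge0. Qed.

Lemma enorm_dot v : enorm v = Num.sqrt (dot v v).
Proof. by rewrite -enormE sqrtr_sqr ger0_norm ?enorm_ge0. Qed.

Lemma enorm0 : enorm (0 : 'rV[R]_d) = 0.
Proof. by rewrite enorm_dot dot0l sqrtr0. Qed.

Lemma enorm_eq0 v : enorm v = 0 -> v = 0.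
Proof.
move=> v0; apply/rowP => i; rewrite mxE.
have /eqP : dot v v = 0 by rewrite -enormE v0 expr0n.
rewrite psumr_eq0 => [/allP/(_ i)|j _]; last by rewrite -expr2 sqr_ge0.
by rewrite mem_index_enum => /(_ isT); rewrite -expr2 sqrf_eq0 => /eqP.
Qed.

Lemma enormN v : enorm (- v) = enorm v.
Proof. by rewrite !enorm_dot dotNl dotNr opprK. Qed.

Lemma enormBC u v : enorm (u - v) = enorm (v - u).
Proof. by rewrite -enormN opprB. Qed.

Lemma enorm2B u v :
  enorm (u - v) ^+ 2 = enorm u ^+ 2 - 2 * dot u v + enorm v ^+ 2.
Proof. by rewrite !enormE dotBl !dotBr (dotC v u); ring. Qed.

Lemma enorm2D_le u v :
  enorm (u + v) ^+ 2 <= 2 * enorm u ^+ 2 + 2 * enorm v ^+ 2.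
Proof.
have := sqr_ge0 (enorm (u - v)).
by rewrite !enormE dotBl !dotBr dotDl !dotDr (dotC v u); lra.
Qed.

Lemma cauchy_schwarz u v : dot u v <= enorm u * enorm v.
Proof.
have [/enorm_eq0 ->|v0] := eqVneq (enorm v) 0.
  by rewrite dot0r enorm0 mulr0.
have [/enorm_eq0 ->|u0] := eqVneq (enorm u) 0.
  by rewrite dot0l enorm0 mul0r.
have ab : 0 < enorm u * enorm v by rewrite mulr_gt0 // lt0r ?u0 ?v0 enorm_ge0.
have := sqr_ge0 (enorm (enorm v *: u - enorm u *: v)).
rewrite enorm2B !enormE !dotZl !dotZr -!enormE => H.
by rewrite -(ler_pM2l ab); lra.
Qed.

Lemma norm_dot_le u v : `|dot u v| <= enorm u * enorm v.
Proof. by rewrite ler_norml cauchy_schwarz lerNl -dotNl -(enormN u) cauchy_schwarz. Qed.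

Lemma coord_le_enorm v i : `|v 0 i| <= enorm v.
Proof.
rewrite -(@ler_sqr _ `|v 0 i|) ?nnegrE ?enorm_ge0 // enormE real_normK ?num_real //.
rewrite /dot (bigD1 i) //= -expr2 lerDl.
by apply: sumr_ge0 => j _; rewrite -expr2 sqr_ge0.
Qed.

Lemma enormD_le u v : enorm (u + v) <= enorm u + enorm v.
Proof.
rewrite -ler_sqr ?nnegrE ?addr_ge0 ?enorm_ge0 //.
have := cauchy_schwarz u v.
by rewrite sqrrD !enormE dotDl !dotDr (dotC v u) mulr2n; lra.
Qed.

(** Minimising the squared distance instead of the norm spares the square root; this feeds the
    extreme value theorem in [proj_spec]. *)
Lemma continuous_sqdist x : continuous (fun u => \sum_(i < d) (x - u) 0 i ^+ 2).
Proof.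
apply: continuous_big => [|i _]; first exact: add_continuous.
have -> : (fun v : 'rV[R]_d => (x - v) 0 i ^+ 2) =
  (fun v => (x 0 i - v 0 i) * (x 0 i - v 0 i)).
  by apply/funext => v; rewrite !mxE expr2.
have cB : continuous (fun v : 'rV[R]_d => x 0 i - v 0 i).
  move=> u; apply: (@continuousB _ _ _ (cst (x 0 i)) (fun v : 'rV[R]_d => v 0 i)).
    exact: cst_continuous.
  exact: coord_continuous.
move=> u; exact: (@continuousM _ _ _ _ _ (cB u) (cB u)).
Qed.

End Euclidean.

(** * Projection onto a bounded closed convex set and one AdaGrad step *)

Section Projection.
Variables (R : realType) (d : nat) (K : set 'rV[R]_d) (D : R).
Hypotheses (Kclosed : closed K) (Kconvex : convex_set_of K).
Hypothesis Kdiam : forall x y, K x -> K y -> enorm (x - y) <= D.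

(** [proj] is a choice with default value 0, so a minimiser has to be exhibited: the diameter bound
    makes [K] compact, and the squared distance attains its minimum there. The point [y] witnesses
    nonemptiness and anchors the boundedness argument. *)
Lemma proj_spec (x y : 'rV[R]_d) : K y ->
  K (Defs.proj K x) /\ forall u, K u -> enorm (x - Defs.proj K x) <= enorm (x - u).
Proof.
move=> Ky; have Kbounded : bounded_set K.
  exists (`|y| + D); split; first exact: num_real.
  move=> M ltM u Ku; apply: le_trans (ltW ltM).
  rewrite -[u](subrK y) addrC (le_trans (ler_normD _ _)) // lerD2l.
  rewrite [leLHS]mx_normrE; apply/bigmax_leP; split => [|[i j] _] /=.
    by rewrite (le_trans (enorm_ge0 (u - y))) ?Kdiam.
  by rewrite (ord1 i) (le_trans (coord_le_enorm _ _)) ?Kdiam.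
have Kcompact := bounded_closed_compact Kbounded Kclosed.
have [c /set_mem Kc cmin] := EVT_min_rV (ex_intro _ y Ky) Kcompact
  (continuous_subspaceT (@continuous_sqdist R d x)).
apply: (@xgetPex _ 0 [set z | K z /\ forall u, K u -> enorm (x - z) <= enorm (x - u)]).
exists c; split => // u Ku; rewrite /enorm ler_wsqrtr //.
by apply: (cmin u); exact/mem_set.
Qed.

(** Comparing the projection [y] with the points of the segment from [y] to [u] yields
    [dot (x - y) (u - y) <= 0]; expanding [x - u] around [y] then concludes. *)
Lemma proj_nonexpansive (x u : 'rV[R]_d) : K u ->
  enorm (Defs.proj K x - u) <= enorm (x - u).
Proof.
move=> Ku; have [Ky ymin] := proj_spec x Ku; set y := Defs.proj K x in Ky ymin *.
set p := dot (x - y) (u - y); set q := enorm (u - y) ^+ 2.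
have q0 : 0 <= q by exact: sqr_ge0.
have descent l : 0 < l -> l <= 1 -> 2 * p <= l * q.
  move=> l0 l1.
  have Kl : K (l *: u + (1 - l) *: y) by apply: Kconvex; rewrite ?l1 ?(ltW l0).
  have := ymin _ Kl; rewrite -ler_sqr ?nnegrE ?enorm_ge0 //.
  have -> : x - (l *: u + (1 - l) *: y) = (x - y) - l *: (u - y).
    by apply/rowP => i; rewrite !mxE; ring.
  rewrite [leRHS]enorm2B dotZr (enormE (l *: _)) dotZl dotZr -enormE -/p -/q => H.
  rewrite -(ler_pM2l l0); lra.
have p0 : p <= 0.
  rewrite leNgt; apply/negP => p0.
  have pq : 0 < p + q by lra.
  (* This [l] lies in []0, 1]] even when [q = 0], and [2 * p <= l * q] becomes
     [2 * p ^+ 2 + p * q <= 0], against [0 < p]. *)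
  have := descent (p / (p + q)).
  rewrite divr_gt0 // ler_pdivrMr // mul1r lerDl q0 => /(_ isT isT).
  rewrite mulrAC ler_pdivlMr //; nra.
rewrite -ler_sqr ?nnegrE ?enorm_ge0 // (enormBC y u).
have -> : x - u = (x - y) - (u - y) by apply/rowP => i; rewrite !mxE; ring.
rewrite [leRHS]enorm2B -/p -/q; have := sqr_ge0 (enorm (x - y)); lra.
Qed.

(** [A] and [A'] are the squared distances to the comparator before and after the step, [s] and [s']
    the roots of the accumulated squared norms. The quadratic term is absorbed through
    [(s' ^+ 2 - s ^+ 2) / s' <= 2 * (s' - s)]. *)
Lemma adagrad_arith (a s s' A A' c D2 : R) :
  0 < a -> 0 < s' -> s <= s' -> A <= D2 ->
  A' <= A - 2 * (a / s' * c) + a / s' * (a / s' * (s' ^+ 2 - s ^+ 2)) ->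
  c <= ((D2 - A') / (2 * a) + a) * s' - ((D2 - A) / (2 * a) + a) * s.
Proof.
move=> ap s'p s's AD.
have s'N : s' != 0 by rewrite gt_eqF.
have -> : a / s' * (a / s' * (s' ^+ 2 - s ^+ 2)) =
  a ^+ 2 * (s' ^+ 2 - s ^+ 2) / s' / s' by field.
move=> H.
have {}H : A' * s' <= A * s' - 2 * a * c + a ^+ 2 * ((s' ^+ 2 - s ^+ 2) / s').
  have := ler_wpM2r (ltW s'p) H; congr (_ <= _); field; exact: s'N.
have : (s' ^+ 2 - s ^+ 2) / s' <= 2 * (s' - s).
  rewrite ler_pdivrMr //; have := sqr_ge0 (s' - s); rewrite sqrrB mulr2n; lra.
move/(ler_wpM2l (sqr_ge0 a)).
(* This trades [- (D2 - A) * s'] for the larger [- (D2 - A) * s], which makes the bound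
   telescope. *)
have : 0 <= (D2 - A) * (s' - s) by rewrite mulr_ge0 ?subr_ge0.
move: ((_ / s')) H => r H AD' Hr.
have a2 : 0 < 2 * a by rewrite mulr_gt0.
have aN : a != 0 by rewrite gt_eqF.
rewrite -(ler_pM2l a2).
have -> : 2 * a * (((D2 - A') / (2 * a) + a) * s' - ((D2 - A) / (2 * a) + a) * s)
  = (D2 - A') * s' - (D2 - A) * s + 2 * a ^+ 2 * (s' - s) by field.
lra.
Qed.

(** [w0] is the comparator and [s] the root of the accumulated squared norms; [D / Num.sqrt 2] is
    the step parameter. For [D = 0] the quotient is a division by zero, hence 0. *)
Definition potential (w0 w : 'rV[R]_d) (s : R) : R :=
  ((D ^+ 2 - enorm (w - w0) ^+ 2) / (2 * (D / Num.sqrt 2)) + D / Num.sqrt 2) * s.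

Lemma adagrad_step (w0 w g : 'rV[R]_d) (acc : R) :
  K w0 -> K w -> 0 <= acc ->
  dot g (w - w0) <=
    potential w0 (Defs.proj K (w - D / Num.sqrt 2 / Num.sqrt (acc + enorm g ^+ 2) *: g))
      (Num.sqrt (acc + enorm g ^+ 2)) - potential w0 w (Num.sqrt acc).
Proof.
move=> K0 Kw acc0; rewrite /potential; set a := D / Num.sqrt 2.
set s' := Num.sqrt (acc + _); set s := Num.sqrt acc.
have D0 : 0 <= D by rewrite (le_trans (enorm_ge0 _) (Kdiam K0 Kw)).
have s's : s <= s' by rewrite ler_wsqrtr // lerDl sqr_ge0.
have s0 : 0 <= s by exact: sqrtr_ge0.
have gE : enorm g ^+ 2 = s' ^+ 2 - s ^+ 2.
  have acc'0 : 0 <= acc + enorm g ^+ 2 by rewrite addr_ge0 ?sqr_ge0.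
  by rewrite (sqr_sqrtr acc0) (sqr_sqrtr acc'0); ring.
(* If [s' = 0], the step size is a division by zero, hence 0; but then [g] is zero and both sides
   vanish. *)
have [s'0|s'N] := eqVneq s' 0.
  have -> : s = 0 by apply/eqP; rewrite eq_le s0 -s'0 s's.
  have : enorm g ^+ 2 = 0.
    by rewrite gE s'0 (_ : s = 0) ?subrr //; apply/eqP; rewrite eq_le s0 -s'0 s's.
  by move/eqP; rewrite sqrf_eq0 => /eqP/enorm_eq0 ->; rewrite dot0l s'0 !mulr0 subr0.
have s'p : 0 < s' by rewrite lt0r s'N sqrtr_ge0.
(* [adagrad_arith] needs a positive step parameter; for [D = 0] the set [K] is a single point and
   both sides vanish. *)
have [D0'|DN] := eqVneq D 0.
  have -> : w = w0.
    apply/subr0_eq/enorm_eq0/eqP.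
    by rewrite eq_le enorm_ge0 -D0' Kdiam.
  have -> : a = 0 by rewrite /a D0' mul0r.
  by rewrite subrr dot0r mulr0 invr0 !mulr0 !addr0 !mul0r subrr.
have ap : 0 < a by rewrite divr_gt0 ?sqrtr_gt0 ?ltr0n // lt_def DN.
set w' := Defs.proj _ _.
have := proj_nonexpansive (w - a / s' *: g) K0; rewrite -/w'.
rewrite -ler_sqr ?nnegrE ?enorm_ge0 //.
have -> : w - a / s' *: g - w0 = (w - w0) - a / s' *: g by rewrite addrAC.
rewrite [leRHS]enorm2B dotZr (enormE (_ *: _)) dotZl dotZr -enormE gE (dotC _ g).
move=> H; apply: adagrad_arith H => //.
by rewrite ler_sqr ?nnegrE ?enorm_ge0 // Kdiam.
Qed.

End Projection.

(** * Gradients and the first-order inequality for the population objective *)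

Section Gradient.
Variables (R : realType) (Omega : finType) (d : nat).
Variables (f : 'rV[R]_d -> Omega -> R) (K : set 'rV[R]_d) (mu : Omega -> R).

Lemma derive_grad (h : 'rV[R]_d -> R) (w v : 'rV[R]_d) :
  differentiable h w -> 'D_v h w = dot (grad h w) v.
Proof.
move=> hw; rewrite deriveE // {1}(row_sum_delta v) linear_sum.
by apply: eq_bigr => i _; rewrite linearZ mxE deriveE // mulrC.
Qed.

Lemma is_derive_popF (w v : 'rV[R]_d) :
  (forall z, differentiable (f^~ z) w) ->
  is_derive w v (popF f mu) (\sum_z mu z * dot (grad (f^~ z) w) v).
Proof.
move=> df; under eq_bigr => z _ do rewrite -derive_grad //.
rewrite /popF; elim: (index_enum Omega) => [|z r IH].
  rewrite big_nil (_ : (fun _ => _) = cst 0); first exact: is_derive_cst.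
  by apply/funext => u; rewrite big_nil.
rewrite big_cons (_ : (fun _ => _) =
  (mu z \*: (f^~ z)) + (fun u => \sum_(x <- r) mu x * f u x)); last first.
  by apply/funext => u; rewrite big_cons.
apply: is_deriveD; apply: is_deriveZ.
exact/derivableP/diff_derivable.
Qed.

(** Convexity bounds the difference quotients along [v - w] for [0 < h <= 1], and the bound passes
    to the limit. The limit is taken from the right, since [w + h (v - w)] may leave [K] for
    negative [h]. *)
Lemma gradient_inequality (w v : 'rV[R]_d) :
  (forall z, differentiable (f^~ z) w) -> convex_on K (popF f mu) ->
  K w -> K v ->
  \sum_z mu z * dot (grad (f^~ z) w) (v - w) <= popF f mu v - popF f mu w.
Proof.
move=> df Fconv Kw Kv; have [dF <-] := is_derive_popF (v - w) df.
have := cvg_dnbhs_at_right dF => /cvgr_to_le; apply.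
near=> h.
have h0 : 0 < h by [].
have h1 : h <= 1 by near: h; exact: nbhs_right_le.
rewrite /=; have -> : h *: (v - w) + w = h *: v + (1 - h) *: w.
  by apply/rowP => i; rewrite !mxE; ring.
have := Fconv _ _ h Kv Kw; rewrite h1 ltW // => /(_ isT) H.
rewrite /GRing.scale /= mulrC ler_pdivrMr //; lra.
Unshelve. all: by end_near. Qed.

End Gradient.

(** * Expectations along the chain and the Markov operator *)

Section Chain.
Variables (R : realType) (Omega : finType) (P : Omega -> Omega -> R).
Hypothesis Pstoch : stochastic P.
Implicit Types (nu : Omega -> R) (s b : seq Omega) (H : seq Omega -> R).

(** Recursive rather than a sum over tuples, so that conditioning on the first state is a
    computation; [sum_path_prob] relates the two forms. *)
Fixpoint expect_chain nu (n : nat) H : R :=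
  if n is n'.+1 then \sum_x nu x * expect_chain (P x) n' (fun s => H (x :: s))
  else H [::].

(** Conditional law of the sample that follows the block [b]; an empty block leaves the initial law
    in place. *)
Definition next_law nu b : Omega -> R :=
  if b is x :: s then P (last x s) else nu.

Lemma is_distr_next nu b : is_distr nu -> is_distr (next_law nu b).
Proof. by case: b => [|x s] //= _; exact: Pstoch. Qed.

Lemma eq_expect_chain nu n H H' :
  (forall b, size b = n -> H b = H' b) ->
  expect_chain nu n H = expect_chain nu n H'.
Proof.
elim: n nu H H' => [|n IH] nu H H' HH' /=; first exact: HH'.
by apply: eq_bigr => x _; congr (_ * _); apply: IH => b bn; apply: HH'; rewrite /= bn.
Qed.

Lemma expect_chain_cst nu n c : is_distr nu -> expect_chain nu n (fun=> c) = c.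
Proof.
elim: n nu => [//|n IH] nu [_ nu1] /=.
under eq_bigr => x _ do rewrite IH //.
by rewrite -mulr_suml nu1 mul1r.
Qed.

Lemma expect_chainD nu n H H' :
  expect_chain nu n (fun b => H b + H' b) =
  expect_chain nu n H + expect_chain nu n H'.
Proof.
elim: n nu H H' => [//|n IH] nu H H' /=.
by rewrite -big_split; apply: eq_bigr => x _; rewrite IH mulrDr.
Qed.

Lemma expect_chainZ nu n c H :
  expect_chain nu n (fun b => c * H b) = c * expect_chain nu n H.
Proof.
elim: n nu H => [//|n IH] nu H /=.
by rewrite mulr_sumr; apply: eq_bigr => x _; rewrite IH mulrCA.
Qed.

Lemma expect_chain_sum (I : Type) (r : seq I) nu n (c : I -> R) (H : I -> seq Omega -> R) :
  expect_chain nu n (fun b => \sum_(i <- r) c i * H i b) =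
  \sum_(i <- r) c i * expect_chain nu n (H i).
Proof.
elim: r => [|i r IH].
  rewrite big_nil -[RHS](mul0r (expect_chain nu n (fun=> 0))) -expect_chainZ.
  by apply: eq_expect_chain => b _; rewrite big_nil mul0r.
rewrite big_cons -IH -expect_chainZ -expect_chainD.
by apply: eq_expect_chain => b _; rewrite big_cons.
Qed.

Lemma ler_expect_chain nu n H H' : is_distr nu ->
  (forall b, size b = n -> H b <= H' b) ->
  expect_chain nu n H <= expect_chain nu n H'.
Proof.
elim: n nu H H' => [|n IH] nu H H' [nu0 _] HH' /=; first exact: HH'.
apply: ler_sum => x _; apply: ler_wpM2l => //; apply: IH => [|b bn]; first exact: Pstoch.
by apply: HH'; rewrite /= bn.
Qed.

(** Markov property: given the first [m] samples, the remaining ones form a chain whose initial law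
    is [next_law]. *)
Lemma expect_chain_cat nu m n H :
  expect_chain nu (m + n) H =
  expect_chain nu m (fun b => expect_chain (next_law nu b) n (fun r => H (b ++ r))).
Proof.
elim: m nu H => [//|m IH] nu H; rewrite addSn /=.
apply: eq_bigr => x _; congr (_ * _); rewrite IH; apply: eq_expect_chain => b _.
by case: b.
Qed.

Lemma expect_chain_take nu m n H : is_distr nu -> (m <= n)%N ->
  expect_chain nu n (fun b => H (take m b)) = expect_chain nu m H.
Proof.
move=> nud mn; rewrite -(subnKC mn) expect_chain_cat; apply: eq_expect_chain => b bm.
rewrite -[RHS](@expect_chain_cst (next_law nu b) (n - m) _ (is_distr_next b nud)).
by apply: eq_expect_chain => r _; rewrite take_size_cat.
Qed.

Lemma big_tuple_cons (T : finType) n (F : seq T -> R) :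
  \sum_(t : n.+1.-tuple T) F t = \sum_x \sum_(t : n.-tuple T) F (x :: t).
Proof.
rewrite pair_big /=.
rewrite (reindex (fun p : T * n.-tuple T => [tuple of p.1 :: p.2])) //=.
exists (fun t : n.+1.-tuple T => (thead t, [tuple of behead t])) => [[x t]|t] _ /=.
  by rewrite theadE; congr (_, _); apply: val_inj.
by rewrite [RHS]tuple_eta; apply: val_inj.
Qed.

Lemma sum_path_prob nu n H :
  \sum_(p : n.-tuple Omega) path_prob nu P p * H p = expect_chain nu n H.
Proof.
have base (F : seq Omega -> R) : \sum_(p : 0.-tuple Omega) F p = F [::].
  by rewrite (big_pred1 [tuple]) // => t; apply/esym/eqP; exact: tuple0.
have chain x m F : \sum_(p : m.-tuple Omega) chain_prob P x p * F (p : seq Omega) =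
    expect_chain (P x) m F.
  elim: m x F => [|m IH] x F.
    by rewrite (base (fun p => chain_prob P x p * F p)) /= mul1r.
  rewrite (@big_tuple_cons _ _ (fun p => chain_prob P x p * F p)) /=.
  apply: eq_bigr => y _; rewrite -(IH y (fun s => F (y :: s))) mulr_sumr.
  by apply: eq_bigr => t _; rewrite mulrA.
case: n => [|n]; first by rewrite (base (fun p => path_prob nu P p * H p)) /= mul1r.
rewrite (@big_tuple_cons _ _ (fun p => path_prob nu P p * H p)) /=.
apply: eq_bigr => y _; rewrite -(chain y n (fun s => H (y :: s))) mulr_sumr.
by apply: eq_bigr => t _; rewrite mulrA.
Qed.

Definition markov_op (phi : Omega -> R) (x : Omega) : R := \sum_y P x y * phi y.

Lemma iter_markov_op n phi x :
  iter n markov_op phi x = \sum_y Pn P n x y * phi y.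
Proof.
elim: n phi x => [|n IH] phi x.
  rewrite /= (bigD1 x) //= eqxx mul1r big1 ?addr0 // => y /negPf yx.
  by rewrite eq_sym yx mul0r.
rewrite iterSr IH /=.
under eq_bigr => u _ do rewrite /markov_op mulr_sumr.
rewrite exchange_big /=; apply: eq_bigr => y _; rewrite mulr_suml.
by apply: eq_bigr => u _; rewrite mulrA.
Qed.

Lemma Pn_distr n : stochastic (Pn P n).
Proof.
elim: n => [|n IH] x /=.
  split=> [y|]; first exact: ler0n.
  rewrite (bigD1 x) //= eqxx big1 ?addr0 // => y /negPf yx; by rewrite eq_sym yx.
split=> [y|]; first by apply: sumr_ge0 => u _; rewrite mulr_ge0 //; [case: (IH x) | case: (Pstoch u)].
rewrite exchange_big /= -[RHS](proj2 (IH x)); apply: eq_bigr => u _.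
by rewrite -mulr_sumr (proj2 (Pstoch u)) mulr1.
Qed.

Definition osc_le (phi : Omega -> R) (B : R) := forall x y, phi x - phi y <= B.

Lemma markov_op_osc phi B : osc_le phi B -> osc_le (markov_op phi) B.
Proof.
move=> oB x y; rewrite /markov_op.
have [x0 x1] := Pstoch x; have [y0 y1] := Pstoch y.
(* Both averages become double sums against the product coupling of [P x] and [P y], where the
   difference is at most [B] pointwise. *)
have -> : \sum_y P x y * phi y = \sum_u \sum_v P x u * P y v * phi u.
  apply: eq_bigr => u _; rewrite -mulr_suml -mulr_sumr y1 mulr1 //.
have -> : \sum_v P y v * phi v = \sum_u \sum_v P x u * P y v * phi v.
  rewrite exchange_big /=; apply: eq_bigr => u _; rewrite -mulr_suml -mulr_suml x1 mul1r //.
rewrite -sumrB; have -> : B = \sum_u \sum_v P x u * P y v * B.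
  under eq_bigr => u _ do rewrite -mulr_suml -mulr_sumr y1 mulr1.
  by rewrite -mulr_suml x1 mul1r.
apply: ler_sum => u _; rewrite -sumrB; apply: ler_sum => v _.
by rewrite -mulrBr ler_wpM2l // mulr_ge0.
Qed.

Lemma iter_markov_op_osc n phi B : osc_le phi B -> osc_le (iter n markov_op phi) B.
Proof. by move=> oB; elim: n => [//|n IH]; exact: markov_op_osc. Qed.

(** * Mixing as contraction of oscillations *)

Section Mixing.
Variables (mu : Omega -> R) (tau : nat).
Hypotheses (mu_stat : stationary P mu) (mix : dmix P mu tau <= 4^-1).

Lemma tv_le z (A : {set Omega}) :
  `| \sum_(x in A) Pn P tau z x - \sum_(x in A) mu x | <= 4^-1.
Proof.
apply: le_trans mix; rewrite /dmix.
apply: le_trans (le_bigmax _ (fun z => tv (Pn P tau z) mu) z).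
exact: (le_bigmax _ (fun A : {set Omega} => `| \sum_(x in A) Pn P tau z x - \sum_(x in A) mu x |)).
Qed.

(** The laws after [tau] steps from [x] and from [y] are both within 1/4 of [mu], so they differ by
    at most 1/2 on any set. Once the minimum of [phi] is subtracted, its values lie between 0 and
    [B], and only the states with [q u <= p u] can contribute positively. *)
Lemma osc_contract phi B : osc_le phi B -> osc_le (iter tau markov_op phi) (B / 2).
Proof.
move=> oB x y; rewrite !iter_markov_op -sumrB.
set m := [arg min_(u < x) phi u]%O.
have mmin u : phi m <= phi u by rewrite /m; case: arg_minP => // i _; apply.
set p := Pn P tau x; set q := Pn P tau y.
pose A : {set Omega} := finset (fun u => q u <= p u).
have -> : \sum_u (p u * phi u - q u * phi u) = \sum_u (p u - q u) * (phi u - phi m).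
  transitivity (\sum_u ((p u * phi u - q u * phi u) - (p u - q u) * phi m)).
    have pq0 : \sum_u (p u - q u) = 0.
      by rewrite sumrB (proj2 (Pn_distr tau x)) (proj2 (Pn_distr tau y)) subrr.
    by rewrite [RHS]sumrB -mulr_suml pq0 mul0r subr0.
  by apply: eq_bigr => u _; ring.
have A1 : \sum_(u in A) (p u - q u) <= 2^-1.
  rewrite sumrB; have := tv_le x A; have := tv_le y A; rewrite -/p -/q !ler_norml.
  by move=> /andP[? ?] /andP[? ?]; lra.
have B0 : 0 <= B by rewrite -(subrr (phi x)) oB.
apply: (@le_trans _ _ (\sum_(u in A) (p u - q u) * B)); last first.
  by rewrite -mulr_suml mulrC ler_wpM2l.
rewrite (bigID (mem A)) /= -[leRHS]addr0; apply: lerD.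
  apply: ler_sum => u; rewrite inE => qp; apply: ler_wpM2l; [by rewrite subr_ge0|exact: oB].
apply: sumr_le0 => u; rewrite inE -ltNge => pq.
by rewrite mulr_le0_ge0 // ?subr_ge0 // subr_le0 ltW.
Qed.

Local Notation tau' := (maxn tau 1).

(** [tau] may be 0. Further steps never increase the oscillation, so halving persists over the
    positive length [tau'], by which an induction on the number of terms can strictly descend. *)
Lemma osc_contract_max phi B :
  osc_le phi B -> osc_le (iter tau' markov_op phi) (B / 2).
Proof.
by move=> oB; rewrite -(subnK (leq_maxl tau 1)) iterD; apply/iter_markov_op_osc/osc_contract.
Qed.

Lemma stationary_iter n phi :
  \sum_x mu x * iter n markov_op phi x = \sum_x mu x * phi x.
Proof.
elim: n => [//|n IH]; rewrite -IH /=; set psi := iter n _ _.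
under eq_bigr => x _ do rewrite /markov_op mulr_sumr.
rewrite exchange_big /=; apply: eq_bigr => y _.
under eq_bigr => x _ do rewrite mulrA.
by rewrite -mulr_suml (proj2 mu_stat).
Qed.

Lemma centered_osc_ge phi B z :
  osc_le phi B -> \sum_x mu x * phi x = 0 -> phi z <= B.
Proof.
move=> oB phi0; have [[mu0 mu1] _] := mu_stat.
have -> : phi z = \sum_x mu x * (phi z - phi x).
  transitivity (\sum_x (mu x * phi z - mu x * phi x)).
    by rewrite sumrB phi0 subr0 -mulr_suml mu1 mul1r.
  by apply: eq_bigr => x _; rewrite mulrBr.
rewrite -[B]mul1r -mu1 mulr_suml; apply: ler_sum => x _.
exact: ler_wpM2l.
Qed.

(* Each block of [tau'] steps halves the oscillation, so the sum is dominated
   by [tau' * B * (1 + 1/2 + 1/4 + ...)]. *)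
Lemma sum_iter_markov_op n phi B z :
  osc_le phi B -> \sum_x mu x * phi x = 0 ->
  \sum_(s < n) iter s markov_op phi z <= 2 * tau'%:R * B.
Proof.
have B0 f C : osc_le f C -> 0 <= C by move=> oC; rewrite -(subrr (f z)) oC.
elim/ltn_ind: n phi B => n IH phi B oB phi0.
have short m : \sum_(s < m) iter s markov_op phi z <= m%:R * B.
  rewrite -[m in m%:R]card_ord -sum1_card natr_sum mulr_suml; apply: ler_sum => s _.
  rewrite mul1r; apply: centered_osc_ge; first exact: iter_markov_op_osc.
  by rewrite stationary_iter.
have [le_n|lt_n] := leqP n tau'.
  apply: le_trans (short n) _; rewrite ler_wpM2r ?(B0 _ _ oB) //.
  by rewrite -natrM ler_nat mul2n -addnn (leq_trans le_n) ?leq_addr.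
rewrite -(subnKC (ltnW lt_n)) big_split_ord /=.
have -> : \sum_(i < n - tau') iter (tau' + i) markov_op phi z =
   \sum_(i < n - tau') iter i markov_op (iter tau' markov_op phi) z.
  by apply: eq_bigr => i _; rewrite addnC iterD.
have nlt : (n - tau' < n)%N by rewrite ltn_subrL leq_max orbT (leq_ltn_trans _ lt_n).
have := IH _ nlt _ _ (osc_contract_max oB).
rewrite stationary_iter => /(_ phi0) H.
have := short tau'; lra.
Qed.

End Mixing.
End Chain.

(** * Second moment of centred sums along the chain *)

Section Variance.
Variables (R : realType) (Omega : finType) (P : Omega -> Omega -> R).
Variables (mu : Omega -> R) (tau d : nat).
Hypotheses (Pstoch : stochastic P) (mu_stat : stationary P mu).
Hypothesis mix : dmix P mu tau <= 4^-1.

Local Notation tau' := (maxn tau 1).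

Lemma expect_chain_sum_iter n (phi : Omega -> R) x :
  expect_chain P (P x) n (fun b => \sum_(y <- b) phi y) =
  \sum_(s < n) iter s.+1 (markov_op P) phi x.
Proof.
elim: n x => [|n IH] x; first by rewrite /= big_nil big_ord0.
rewrite big_ord_recl /=.
have -> : \sum_(i < n) markov_op P (iter (bump 0 i) (markov_op P) phi) x =
    \sum_y P x y * \sum_(i < n) iter i.+1 (markov_op P) phi y.
  under [RHS]eq_bigr => y _ do rewrite mulr_sumr.
  by rewrite exchange_big.
rewrite /markov_op -big_split /=; apply: eq_bigr => y _; rewrite -mulrDr -IH; congr (_ * _).
rewrite -[phi y in RHS](expect_chain_cst Pstoch n (phi y) (Pstoch y)) -expect_chainD.
by apply: eq_expect_chain => b _; rewrite big_cons.
Qed.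

Variables (a : Omega -> 'rV[R]_d) (A : R).
Hypothesis a_centered : forall c, \sum_z mu z * dot c (a z) = 0.
Hypothesis a_bound : forall z, enorm (a z) <= A.

(** For fixed [x], [phi] has mean zero under [mu] and oscillation at most [2 * A ^+ 2], so
    [sum_iter_markov_op] applies. It is applied to [markov_op P phi] because the first sample of [b]
    is already one step after [x]. *)
Lemma expect_correlation x n :
  expect_chain P (P x) n (fun b => dot (a x) (\sum_(y <- b) a y)) <=
  4 * tau'%:R * A ^+ 2.
Proof.
have A0 : 0 <= A by rewrite (le_trans (enorm_ge0 _) (a_bound x)).
pose phi y := dot (a x) (a y).
have -> : expect_chain P (P x) n (fun b => dot (a x) (\sum_(y <- b) a y)) =
    \sum_(s < n) iter s (markov_op P) (markov_op P phi) x.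
  under [RHS]eq_bigr => s _ do rewrite -iterSr.
  rewrite -expect_chain_sum_iter; apply: eq_expect_chain => b _.
  by rewrite dotC dot_suml; apply: eq_bigr => y _; rewrite dotC.
have phi_le y : `|phi y| <= A ^+ 2.
  by rewrite (le_trans (norm_dot_le _ _)) // expr2 ler_pM ?enorm_ge0.
have -> : 4 * tau'%:R * A ^+ 2 = 2 * tau'%:R * (2 * A ^+ 2) by ring.
apply: (sum_iter_markov_op Pstoch mu_stat mix).
  apply: markov_op_osc => // y z.
  have := phi_le y; have := phi_le z; rewrite !ler_norml => /andP[? ?] /andP[? ?]; lra.
by rewrite (@stationary_iter _ _ _ _ mu_stat 1) a_centered.
Qed.

(** Expanding the square around the first sample costs at most [A ^+ 2] plus twice a correlation,
    whence [9 = 1 + 2 * 4]. The bound is uniform in the initial law because the induction restarts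
    from [P x]. *)
Lemma expect_sqnorm_sum nu n : is_distr nu ->
  expect_chain P nu n (fun b => enorm (\sum_(y <- b) a y) ^+ 2) <=
  n%:R * (9 * tau'%:R * A ^+ 2).
Proof.
elim: n nu => [|n IH] nu nud /=; first by rewrite big_nil enorm0 expr0n /= mul0r.
have tau1 : 1 <= tau'%:R :> R by rewrite ler1n leq_maxr.
set C := (leRHS); have -> : C = \sum_x nu x * C by rewrite -mulr_suml (proj2 nud) mul1r.
apply: ler_sum => x _; rewrite {}/C; apply: ler_wpM2l; first exact: (proj1 nud).
have -> : expect_chain P (P x) n (fun s => enorm (\sum_(y <- x :: s) a y) ^+ 2) =
  enorm (a x) ^+ 2 + (2 * expect_chain P (P x) n (fun b => dot (a x) (\sum_(y <- b) a y)) +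
  expect_chain P (P x) n (fun b => enorm (\sum_(y <- b) a y) ^+ 2)).
  rewrite -[enorm (a x) ^+ 2 in RHS](expect_chain_cst Pstoch n _ (Pstoch x)).
  rewrite -expect_chainZ -!expect_chainD; apply: eq_expect_chain => b _.
  by rewrite big_cons !enormE dotDl !dotDr (dotC _ (a x)); ring.
have := IH _ (Pstoch x); have := expect_correlation x n.
have : enorm (a x) ^+ 2 <= tau'%:R * A ^+ 2.
  apply: (@le_trans _ _ (A ^+ 2)); last by rewrite ler_peMl ?sqr_ge0.
  by rewrite ler_sqr ?nnegrE ?enorm_ge0 // (le_trans (enorm_ge0 _) (a_bound x)).
have -> : n.+1%:R = n%:R + 1 :> R by rewrite natr1.
lra.
Qed.

End Variance.

(** * Joint expectation over the draws and the trajectory *)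

Section Step.
Variables (R : realType) (Omega : finType) (P : Omega -> Omega -> R) (N : nat).
Hypothesis Pstoch : stochastic P.
Implicit Types (nu : Omega -> R) (H : nat -> seq Omega -> R).

(* Law of a draw [J] truncated at [N]: the mass of the tail [j > N] is moved to
   [j = 0], where the estimator degenerates to the plain gradient [g^0]. *)
Definition level_prob (j : nat) : R := (2 ^+ (if j == 0%N then N else j))^-1.

Lemma level_prob_ge0 j : 0 <= level_prob j.
Proof. by rewrite invr_ge0 exprn_ge0. Qed.

Lemma sum_level_prob : \sum_(j < N.+1) level_prob j = 1.
Proof.
rewrite big_ord_recl /= {1}/level_prob /=.
under eq_bigr => i _ do rewrite /level_prob /=.
elim: N => [|n IH]; first by rewrite big_ord0 expr0 invr1 addr0.
rewrite big_ord_recr /= -[RHS]IH.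
have -> : (2 ^+ n)^-1 = (2 ^+ n.+1)^-1 + (2 ^+ n.+1)^-1 :> R.
  rewrite exprS invfM; lra.
by rewrite /bump /= add1n -!addrA; congr (_ + _); rewrite addrC.
Qed.

Definition expect_step nu H : R :=
  \sum_(j < N.+1) level_prob j * expect_chain P nu (2 ^ j) (H j).

Lemma eq_expect_step nu H H' :
  (forall j b, size b = (2 ^ j)%N -> H j b = H' j b) ->
  expect_step nu H = expect_step nu H'.
Proof.
move=> HH'; apply: eq_bigr => j _; congr (_ * _).
by apply: eq_expect_chain => b; exact: HH'.
Qed.

Lemma ler_expect_step nu H H' : is_distr nu ->
  (forall j b, size b = (2 ^ j)%N -> H j b <= H' j b) ->
  expect_step nu H <= expect_step nu H'.
Proof.
move=> nud HH'; apply: ler_sum => j _; apply: ler_wpM2l; first exact: level_prob_ge0.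
by apply: ler_expect_chain => // b; exact: HH'.
Qed.

Lemma expect_step_cst nu c : is_distr nu -> expect_step nu (fun _ _ => c) = c.
Proof.
move=> nud; rewrite /expect_step.
under eq_bigr => j _ do rewrite expect_chain_cst //.
by rewrite -mulr_suml sum_level_prob mul1r.
Qed.

Lemma expect_stepD nu H H' :
  expect_step nu (fun j b => H j b + H' j b) = expect_step nu H + expect_step nu H'.
Proof.
rewrite /expect_step -big_split /=; apply: eq_bigr => j _.
by rewrite -mulrDr -expect_chainD.
Qed.

Lemma expect_stepZ nu c H :
  expect_step nu (fun j b => c * H j b) = c * expect_step nu H.
Proof.
by rewrite mulr_sumr; apply: eq_bigr => j _; rewrite expect_chainZ mulrCA.
Qed.

(** Jensen's inequality, read off from the nonnegative variance of [Num.sqrt (H j b)]. *)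
Lemma expect_step_sqrt nu H : is_distr nu -> (forall j b, 0 <= H j b) ->
  expect_step nu (fun j b => Num.sqrt (H j b)) <= Num.sqrt (expect_step nu H).
Proof.
move=> nud H0; set m := expect_step nu (fun j b => Num.sqrt (H j b)).
have m0 : 0 <= m.
  by rewrite -(expect_step_cst 0 nud); apply: ler_expect_step => // j b _; exact: sqrtr_ge0.
rewrite -[m]ger0_norm // -sqrtr_sqr ler_wsqrtr //.
have : 0 <= expect_step nu (fun j b => (Num.sqrt (H j b) - m) ^+ 2).
  by rewrite -(expect_step_cst 0 nud); apply: ler_expect_step => // j b _; exact: sqr_ge0.
have -> : expect_step nu (fun j b => (Num.sqrt (H j b) - m) ^+ 2) =
    expect_step nu (fun j b => H j b + (- 2 * m * Num.sqrt (H j b) + m ^+ 2)).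
  apply: eq_expect_step => j b _; rewrite -{2}(sqr_sqrtr (H0 j b)); ring.
rewrite !expect_stepD expect_stepZ expect_step_cst // -/m; lra.
Qed.

(** Each block starts from the law dictated by the previous one, so a bound valid for every initial
    law is at once a bound conditional on the past. *)
Fixpoint expect_run (n : nat) nu (H : seq nat -> seq Omega -> R) : R :=
  if n is n'.+1 then
    expect_step nu (fun j b =>
      expect_run n' (next_law P nu b) (fun Js s => H (j :: Js) (b ++ s)))
  else H [::] [::].

Lemma expect_runS n nu (H : seq nat -> seq Omega -> R) :
  expect_run n.+1 nu H = expect_step nu (fun j b =>
    expect_run n (next_law P nu b) (fun Js s => H (j :: Js) (b ++ s))).
Proof. by []. Qed.

Lemma expect_run_addl n nu c (H : seq nat -> seq Omega -> R) : is_distr nu ->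
  expect_run n nu (fun Js s => c + H Js s) = c + expect_run n nu H.
Proof.
elim: n nu H => [//|n IH] nu H nud /=.
rewrite -[c in RHS](expect_step_cst c nud) -expect_stepD; apply: eq_expect_step => j b _.
by rewrite IH //; exact: is_distr_next.
Qed.

Lemma expect_runZ n nu c (H : seq nat -> seq Omega -> R) :
  expect_run n nu (fun Js s => c * H Js s) = c * expect_run n nu H.
Proof.
elim: n nu H => [//|n IH] nu H; rewrite !expect_runS -expect_stepZ.
by apply: eq_expect_step => j b _; rewrite IH.
Qed.

Lemma ler_expect_run n nu (H H' : seq nat -> seq Omega -> R) : is_distr nu ->
  (forall Js s, size Js = n -> H Js s <= H' Js s) ->
  expect_run n nu H <= expect_run n nu H'.
Proof.
elim: n nu H H' => [|n IH] nu H H' nud HH'; first exact: HH'.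
rewrite !expect_runS; apply: ler_expect_step => // j b _.
apply: IH => [|Js s sn]; first exact: is_distr_next.
by apply: HH'; rewrite /= sn.
Qed.

(** The length of the trajectory depends on the draws: peeling off the first draw [j] splits the
    trajectory after [2 ^ j] samples, by the Markov property. *)
Lemma sum_run_prob n nu (H : seq nat -> seq Omega -> R) :
  \sum_(J : n.-tuple 'I_N.+1) (\prod_(j <- J) level_prob j) *
    expect_chain P nu (nsamples [seq val j | j <- J]) (H [seq val j | j <- J]) =
  expect_run n nu H.
Proof.
elim: n nu H => [|n IH] nu H.
  rewrite (big_pred1 [tuple]) => [|t]; last exact/esym/eqP/tuple0.
  by rewrite big_nil mul1r /= /nsamples big_nil.
rewrite (@big_tuple_cons _ _ _ (fun J => (\prod_(j <- J) level_prob (j : 'I_N.+1)) *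
    expect_chain P nu (nsamples [seq val j | j <- J]) (H [seq val j | j <- J]))) /=.
apply: eq_bigr => j _.
under eq_bigr => t _.
  rewrite big_cons /nsamples big_cons -/(nsamples _) expect_chain_cat -mulrA.
  over.
rewrite -mulr_sumr -expect_chain_sum; congr (_ * _).
by apply: eq_expect_chain => b _; rewrite -IH.
Qed.

End Step.

(** * Bias and second moment of the multilevel gradient estimator *)

Section Estimator.
Variables (R : realType) (Omega : finType) (P : Omega -> Omega -> R).
Variables (mu : Omega -> R) (tau d : nat) (f : 'rV[R]_d -> Omega -> R).
Variables (G : R) (w : 'rV[R]_d) (T N : nat).
Hypotheses (Pstoch : stochastic P) (mu_stat : stationary P mu).
Hypothesis mix : dmix P mu tau <= 4^-1.
Hypothesis grad_bound : forall z, enorm (grad (f^~ z) w) <= G.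

Local Notation kappa := (36 * G ^+ 2 * (maxn tau 1)%:R).
Local Notation L := (trunc_log 2 T).

Lemma kappa_ge0 : 0 <= kappa.
Proof. by apply: mulr_ge0 => //; apply: mulr_ge0; [exact: ler0n|exact: sqr_ge0]. Qed.

Definition mean_grad : 'rV[R]_d := \sum_z mu z *: grad (f^~ z) w.

Lemma dot_mean_grad v : dot mean_grad v = \sum_z mu z * dot (grad (f^~ z) w) v.
Proof. by rewrite dot_suml; apply: eq_bigr => z _; rewrite dotZl. Qed.

Lemma enorm_mean_grad : enorm mean_grad <= G.
Proof.
have [[mu0 mu1] _] := mu_stat.
have [->|m0] := eqVneq (enorm mean_grad) 0.
  (* A state exists because [mu] has total mass 1, and the gradient there gives [0 <= G]. *)
  have [z _|none] := pickP (fun=> true : bool) (T := Omega).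
    by rewrite (le_trans (enorm_ge0 _) (grad_bound z)).
  by move: mu1; rewrite big_pred0 // => /eqP; rewrite eq_sym oner_eq0.
have mp : 0 < enorm mean_grad by rewrite lt_def m0 enorm_ge0.
rewrite -(ler_pM2r mp) -expr2 enormE dot_mean_grad.
rewrite -[leRHS]mul1r -mu1 mulr_suml; apply: ler_sum => z _.
apply: ler_wpM2l => //; apply: le_trans (cauchy_schwarz _ _) _.
by rewrite ler_wpM2r ?enorm_ge0.
Qed.

Lemma gavg_centered k (b : seq Omega) : (2 ^ k <= size b)%N ->
  gavg f b w k - mean_grad =
  (2 ^+ k)^-1 *: \sum_(z <- take (2 ^ k) b) (grad (f^~ z) w - mean_grad).
Proof.
move=> kb; rewrite sumrB scalerBr; congr (_ - _).
rewrite big_const_seq count_predT size_takel // iter_addr_0 -[mean_grad *+ _]scaler_nat scalerA.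
by rewrite natrX mulVf ?scale1r // expf_neq0.
Qed.

(** Centred gradients have norm at most [2 * G], whence [36 = 9 * 2 ^ 2] in [kappa]; the second
    moment of their sum over [2 ^ k] samples is divided by [4 ^ k]. *)
Lemma gavg_mse nu j k : is_distr nu -> (k <= j)%N ->
  expect_chain P nu (2 ^ j) (fun b => enorm (gavg f b w k - mean_grad) ^+ 2) <=
  kappa / 2 ^+ k.
Proof.
move=> nud kj; have [[mu0 mu1] _] := mu_stat.
pose a z := grad (f^~ z) w - mean_grad.
have a_centered c : \sum_z mu z * dot c (a z) = 0.
  under eq_bigr => z _ do rewrite dotBr mulrBr dotC.
  by rewrite sumrB -dot_mean_grad -mulr_suml mu1 mul1r dotC subrr.
have a_bound z : enorm (a z) <= 2 * G.
  rewrite (le_trans (enormD_le _ _)) // enormN mulr2n mulrDl mul1r.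
  by rewrite lerD ?enorm_mean_grad.
have le2 : (2 ^ k <= 2 ^ j)%N by rewrite leq_exp2l.
have -> : expect_chain P nu (2 ^ j) (fun b => enorm (gavg f b w k - mean_grad) ^+ 2) =
    (2 ^+ k)^-1 ^+ 2 * expect_chain P nu (2 ^ k) (fun b => enorm (\sum_(z <- b) a z) ^+ 2).
  rewrite -(expect_chain_take Pstoch _ nud le2) -expect_chainZ.
  apply: eq_expect_chain => b bj; rewrite gavg_centered ?bj //.
  by rewrite enormE dotZl dotZr -enormE mulrA -expr2.
have := expect_sqnorm_sum Pstoch mu_stat mix a_centered a_bound (2 ^ k) nud.
have k0 : 0 <= (2 ^+ k)^-1 ^+ 2 :> R by exact: sqr_ge0.
move/(ler_wpM2l k0)/le_trans; apply; rewrite natrX le_eqVlt; apply/orP; left; apply/eqP.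
by field; rewrite expf_neq0.
Qed.

(** The centred inner product has expectation [- e]; nonnegativity of its variance bounds [e ^+ 2]
    by its second moment, hence by Cauchy-Schwarz and [gavg_mse]. *)
Lemma gavg_bias nu k v : is_distr nu ->
  dot mean_grad v - expect_chain P nu (2 ^ k) (fun b => dot (gavg f b w k) v) <=
  enorm v * Num.sqrt (kappa / 2 ^+ k).
Proof.
move=> nud; set s := Num.sqrt _; set e := _ - _.
have k0 : 0 <= kappa / 2 ^+ k.
  by rewrite divr_ge0 ?kappa_ge0 ?exprn_ge0.
have mse := gavg_mse nud (leqnn k).
have eE : expect_chain P nu (2 ^ k) (fun b => dot (gavg f b w k - mean_grad) v) = - e.
  rewrite /e opprB -[in RHS](expect_chain_cst Pstoch (2 ^ k) (- dot mean_grad v) nud).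
  by rewrite -expect_chainD; apply: eq_expect_chain => b _; rewrite dotBl.
have [|e0] := leP e 0.
  by move/le_trans; apply; rewrite mulr_ge0 ?enorm_ge0 ?sqrtr_ge0.
rewrite -ler_sqr ?nnegrE ?mulr_ge0 ?enorm_ge0 ?sqrtr_ge0 ?(ltW e0) //.
rewrite exprMn (sqr_sqrtr k0).
have : 0 <= expect_chain P nu (2 ^ k)
    (fun b => (dot (gavg f b w k - mean_grad) v + e) ^+ 2).
  rewrite -(expect_chain_cst Pstoch (2 ^ k) 0 nud).
  by apply: ler_expect_chain => // b _; exact: sqr_ge0.
have : expect_chain P nu (2 ^ k) (fun b => dot (gavg f b w k - mean_grad) v ^+ 2) <=
    enorm v ^+ 2 * (kappa / 2 ^+ k).
  apply: (@le_trans _ _ (expect_chain P nu (2 ^ k)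
    (fun b => enorm v ^+ 2 * enorm (gavg f b w k - mean_grad) ^+ 2))).
    apply: ler_expect_chain => // b _; rewrite -exprMn mulrC -(real_normK (num_real (dot _ _))).
    by rewrite ler_sqr ?nnegrE ?mulr_ge0 ?enorm_ge0 // norm_dot_le.
  by rewrite expect_chainZ ler_wpM2l ?sqr_ge0.
have -> : expect_chain P nu (2 ^ k) (fun b => (dot (gavg f b w k - mean_grad) v + e) ^+ 2)
  = expect_chain P nu (2 ^ k) (fun b => dot (gavg f b w k - mean_grad) v ^+ 2 +
    (2 * e * dot (gavg f b w k - mean_grad) v + e ^+ 2)).
  apply: eq_expect_chain => b _; ring.
rewrite !expect_chainD expect_chainZ expect_chain_cst //.
rewrite eE; lra.
Qed.

Lemma enorm_gavg0 (b : seq Omega) : (0 < size b)%N -> enorm (gavg f b w 0) <= G.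
Proof.
case: b => [//|z b] _; rewrite /gavg expn0 /= take0 big_seq1 expr0 invr1 scale1r.
exact: grad_bound.
Qed.

Hypotheses (T1 : (1 <= T)%N) (LN : (L <= N)%N).

Lemma leq_trunc_log j : (2 ^ j <= T)%N = (j <= L)%N.
Proof.
apply/idP/idP => [|jL]; first exact: trunc_log_max.
by apply: leq_trans (trunc_logP (isT : (1 < 2)%N) T1); rewrite leq_exp2l.
Qed.

(* The correction terms telescope: in expectation the estimator is as good as
   the average over [2 ^ L] consecutive samples. *)
Lemma expect_mag_g nu v : is_distr nu ->
  expect_step P N nu (fun j b => dot (mag_g f T j b w) v) =
  expect_chain P nu (2 ^ L) (fun b => dot (gavg f b w L) v).
Proof.
move=> nud; pose c k := expect_chain P nu (2 ^ k) (fun b => dot (gavg f b w k) v).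
have cE j k : (k <= j)%N ->
    expect_chain P nu (2 ^ j) (fun b => dot (gavg f b w k) v) = c k.
  move=> kj; have le2 : (2 ^ k <= 2 ^ j)%N by rewrite leq_exp2l.
  rewrite /c -(expect_chain_take Pstoch _ nud le2); apply: eq_expect_chain => b _.
  by rewrite /gavg -take_min minnn.
have gE j : expect_chain P nu (2 ^ j) (fun b => dot (mag_g f T j b w) v) =
    c 0%N + (if (j <= L)%N then 2 ^+ j * (c j - c j.-1) else 0).
  rewrite /mag_g leq_trunc_log; case: ifP => _; last by rewrite addr0 cE.
  have -> : expect_chain P nu (2 ^ j) (fun b =>
        dot (gavg f b w 0 + 2 ^+ j *: (gavg f b w j - gavg f b w j.-1)) v) =
      expect_chain P nu (2 ^ j) (fun b => dot (gavg f b w 0) v +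
        2 ^+ j * (dot (gavg f b w j) v + -1 * dot (gavg f b w j.-1) v)).
    by apply: eq_expect_chain => b _; rewrite dotDl dotZl dotBl mulN1r.
  by rewrite expect_chainD expect_chainZ expect_chainD expect_chainZ !cE ?leq_pred // mulN1r.
rewrite /expect_step.
under eq_bigr => j _ do rewrite gE mulrDr.
rewrite big_split /= -mulr_suml sum_level_prob mul1r big_ord_recl /=.
(* At level 0 the correction is [c 0 - c 0.-1], which vanishes as [0.-1 = 0]: the mass moved there
   only sees the plain gradient. *)
rewrite subrr !mulr0 add0r.
have -> : \sum_(i < N) level_prob R N (bump 0 i) *
    (if (bump 0 i <= L)%N then 2 ^+ bump 0 i * (c (bump 0 i) - c (bump 0 i).-1) else 0) =
    \sum_(i < N) (if (i < L)%N then c i.+1 - c i else 0).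
  apply: eq_bigr => i _; rewrite /level_prob /bump add1n /=.
  by case: ifP => _; rewrite ?mulr0 // mulrA mulVf ?mul1r // expf_neq0.
(* The probabilities have cancelled the factors [2 ^+ j], so the corrections telescope; [L <= N]
   guarantees that all of them occur. *)
suff -> n : \sum_(i < n) (if (i < L)%N then c i.+1 - c i else 0) = c (minn n L) - c 0%N.
  by rewrite (minn_idPr LN) addrC subrK.
elim: n => [|n IH]; first by rewrite big_ord0 min0n subrr.
rewrite big_ord_recr /= IH; case: ltnP => nL.
  by rewrite (minn_idPl nL) addrC addrA subrK.
by rewrite addr0 (minn_idPr (leqW nL)).
Qed.

(** Two uses of [enorm2D_le] bound the correction at level [j] by [4 * 4 ^ j] times the errors at
    levels [j] and [j - 1], which add up to at most [3 * kappa / 2 ^ j] in expectation. After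
    weighting by [2 ^ - j], each level from 1 to [L] contributes [12 * kappa]. *)
Lemma expect_sqnorm_mag_g nu : is_distr nu ->
  expect_step P N nu (fun j b => enorm (mag_g f T j b w) ^+ 2) <=
  2 * G ^+ 2 + 12 * kappa * L%:R.
Proof.
move=> nud; have kappa0 := kappa_ge0.
have g0 (b : seq Omega) : (0 < size b)%N -> enorm (gavg f b w 0) ^+ 2 <= G ^+ 2.
  move=> b0; rewrite ler_sqr ?nnegrE ?enorm_ge0 ?enorm_gavg0 //.
  exact: le_trans (enorm_ge0 _) (enorm_gavg0 b0).
pose bound j : R := 2 * G ^+ 2 + (if (0 < j <= L)%N then 12 * kappa * 2 ^+ j else 0).
have gE j : expect_chain P nu (2 ^ j) (fun b => enorm (mag_g f T j b w) ^+ 2) <= bound j.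
  rewrite /mag_g leq_trunc_log /bound; case: j => [|j].
    rewrite ltnn leq0n [X in _ <= _ + X]/= addr0 -(expect_chain_cst Pstoch (2 ^ 0) (2 * G ^+ 2) nud).
    apply: ler_expect_chain => // b b1; rewrite subrr scaler0 addr0.
    have := g0 b; rewrite b1 => /(_ isT); have := sqr_ge0 G; lra.
  rewrite ltn0Sn andTb; case: ifP => _; last first.
    rewrite addr0 -(expect_chain_cst Pstoch (2 ^ j.+1) (2 * G ^+ 2) nud).
    apply: ler_expect_chain => // b b1.
    have := g0 b; rewrite b1 expn_gt0 => /(_ isT); have := sqr_ge0 G; lra.
  have mj := gavg_mse nud (leqnn j.+1); have mj' := gavg_mse nud (leqnSn j).
  apply: (@le_trans _ _ (expect_chain P nu (2 ^ j.+1) (fun b => 2 * G ^+ 2 +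
     4 * (2 ^+ j.+1) ^+ 2 * (enorm (gavg f b w j.+1 - mean_grad) ^+ 2 +
       enorm (gavg f b w j - mean_grad) ^+ 2)))).
    apply: ler_expect_chain => // b b1.
    apply: le_trans (enorm2D_le _ _) _; apply: lerD.
      by rewrite ler_pM2l // g0 // b1 expn_gt0.
    rewrite (enormE (_ *: _)) dotZl dotZr -enormE.
    have -> : gavg f b w j.+1 - gavg f b w j =
      (gavg f b w j.+1 - mean_grad) + - (gavg f b w j - mean_grad).
      by apply/rowP => i; rewrite !mxE; ring.
    have := enorm2D_le (gavg f b w j.+1 - mean_grad) (- (gavg f b w j - mean_grad)).
    rewrite enormN => /(ler_wpM2l (sqr_ge0 (2 ^+ j.+1))); rewrite [in X in X -> _]expr2; lra.
  rewrite expect_chainD expect_chain_cst // expect_chainZ expect_chainD lerD2l.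
  have e0 : 0 < 2 ^+ j :> R by rewrite exprn_gt0.
  move: mj mj'; rewrite (exprS (2 : R) j); set e := 2 ^+ j in e0 *; set k := kappa in kappa0 *.
  move=> mj mj'; have := lerD mj mj'.
  have -> : k / (2 * e) + k / e = 3 / 2 * k / e by field; rewrite gt_eqF.
  have e4 : 0 <= 4 * (2 * e) ^+ 2 by rewrite mulr_ge0 ?sqr_ge0.
  move/(ler_wpM2l e4)/le_trans; apply.
  rewrite le_eqVlt; apply/orP; left; apply/eqP; field; rewrite gt_eqF //.
apply: (@le_trans _ _ (\sum_(j < N.+1) level_prob R N j * bound j)).
  by apply: ler_sum => j _; rewrite ler_wpM2l ?level_prob_ge0.
rewrite /bound; under eq_bigr => j _ do rewrite mulrDr.
rewrite big_split /= -mulr_suml sum_level_prob mul1r lerD2l big_ord_recl /=.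
rewrite mulr0 add0r.
have -> : \sum_(i < N) level_prob R N (bump 0 i) *
    (if (0 < bump 0 i <= L)%N then 12 * kappa * 2 ^+ bump 0 i else 0) =
    \sum_(i < N) (if (i < L)%N then 12 * kappa else 0).
  apply: eq_bigr => i _; rewrite /level_prob /bump add1n /=.
  by case: ifP => _; rewrite ?mulr0 // mulrC mulfK // expf_neq0.
suff -> n : \sum_(i < n) (if (i < L)%N then 12 * kappa else 0) =
    12 * kappa * (minn n L)%:R by rewrite (minn_idPr LN).
elim: n => [|n IH]; first by rewrite big_ord0 min0n mulr0.
rewrite big_ord_recr /= IH; case: ltnP => nL.
  by rewrite (minn_idPl nL) -(natr1 n) mulrDr mulr1.
by rewrite addr0 (minn_idPr (leqW nL)).
Qed.

End Estimator.

(** * Expected regret of the iterates *)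

Section Regret.
Variables (R : realType) (Omega : finType) (P : Omega -> Omega -> R).
Variables (mu : Omega -> R) (tau d : nat) (f : 'rV[R]_d -> Omega -> R).
Variables (K : set 'rV[R]_d) (G D : R) (wstar : 'rV[R]_d) (T N : nat).
Hypotheses (Pstoch : stochastic P) (mu_stat : stationary P mu).
Hypothesis mix : dmix P mu tau <= 4^-1.
Hypotheses (Kclosed : closed K) (Kconvex : convex_set_of K).
Hypothesis Kdiam : forall x y, K x -> K y -> enorm (x - y) <= D.
Hypothesis fdiff : forall z w, differentiable (f^~ z) w.
Hypothesis Fconvex : convex_on K (popF f mu).
Hypothesis grad_bound : forall w z, K w -> enorm (grad (f^~ z) w) <= G.
Hypotheses (Kstar : K wstar) (T1 : (1 <= T)%N) (LN : (trunc_log 2 T <= N)%N).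

Local Notation F := (popF f mu).
Local Notation kappa := (36 * G ^+ 2 * (maxn tau 1)%:R).
Local Notation L := (trunc_log 2 T).
Local Notation alpha := (D / Num.sqrt 2).

Definition bias_bound : R := D * Num.sqrt (kappa / 2 ^+ L).

Definition moment_bound : R := 2 * G ^+ 2 + 12 * kappa * L%:R.

Lemma moment_bound_ge0 : 0 <= moment_bound.
Proof.
apply: addr_ge0; apply: mulr_ge0 => //; first exact: sqr_ge0.
by apply: mulr_ge0 => //; exact: kappa_ge0.
Qed.

(** Convexity bounds the gap by the inner product with the mean gradient; replacing the latter by
    the estimator costs the bias, with [enorm (w - wstar) <= D]. *)
Lemma mag_step_gap nu w : is_distr nu -> K w ->
  F w - F wstar <=
  expect_step P N nu (fun j b => dot (mag_g f T j b w) (w - wstar)) + bias_bound.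
Proof.
move=> nud Kw; have gw z := grad_bound z Kw.
rewrite (expect_mag_g f w Pstoch T1 LN) //.
have := gavg_bias Pstoch mu_stat mix gw L (w - wstar) nud.
have : enorm (w - wstar) * Num.sqrt (kappa / 2 ^+ L) <= bias_bound.
  by rewrite ler_wpM2r ?sqrtr_ge0 // Kdiam.
have := @gradient_inequality _ _ _ f K mu w wstar (fdiff^~ w) Fconvex Kw Kstar.
rewrite -dot_mean_grad -opprB dotNr; lra.
Qed.

Local Notation Psi := (potential D wstar).

(** Without the squared distance the coefficient is [D^2 / (2 alpha) + alpha]; for
    [alpha = D / Num.sqrt 2] and [D] nonzero the two terms are equal and sum to [Num.sqrt 2 * D]. *)
Lemma potential_le w s : 0 <= D -> 0 <= s -> Psi w s <= Num.sqrt 2 * D * s.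
Proof.
move=> D0 s0; rewrite /potential ler_wpM2r //.
have q2 : Num.sqrt 2 ^+ 2 = 2 :> R by rewrite sqr_sqrtr.
have q0 : 0 < Num.sqrt 2 :> R by rewrite sqrtr_gt0.
have [->|DN] := eqVneq D 0; first by rewrite !mul0r mulr0 invr0 mulr0 addr0 mulr0.
have DE : D / Num.sqrt 2 = Num.sqrt 2 * D / 2.
  have qN : Num.sqrt 2 != 0 :> R by rewrite gt_eqF.
  apply: (mulIf qN); rewrite divfK //.
  have -> : Num.sqrt 2 * D / 2 * Num.sqrt 2 = Num.sqrt 2 ^+ 2 * (D / 2) by ring.
  by rewrite q2; field.
rewrite DE; have a0 : 0 < Num.sqrt 2 * D by rewrite mulr_gt0 // lt_def DN.
have -> : 2 * (Num.sqrt 2 * D / 2) = Num.sqrt 2 * D by field.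
suff : (D ^+ 2 - enorm (w - wstar) ^+ 2) / (Num.sqrt 2 * D) <= Num.sqrt 2 * D / 2 by lra.
rewrite ler_pdivrMr //.
have -> : Num.sqrt 2 * D / 2 * (Num.sqrt 2 * D) = D ^+ 2.
  have -> : Num.sqrt 2 * D / 2 * (Num.sqrt 2 * D) = Num.sqrt 2 ^+ 2 * (D ^+ 2 / 2) by ring.
  by rewrite q2; field.
by rewrite gerBl sqr_ge0.
Qed.

(** Stated for arbitrary law, point and accumulator, since all three change after a block. The last
    term majorises the terminal potential. *)
Lemma expected_regret n nu w acc : is_distr nu -> K w -> 0 <= acc ->
  expect_run P N n nu (fun Js s =>
    \sum_(u <- mag_iters f K T alpha Js s w acc) (F u - F wstar)) <=
  n%:R * bias_bound - Psi w (Num.sqrt acc) +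
  Num.sqrt 2 * D * Num.sqrt (acc + n%:R * moment_bound).
Proof.
elim: n nu w acc => [|n IH] nu w acc nud Kw acc0.
  have D0 : 0 <= D by rewrite (le_trans (enorm_ge0 _) (Kdiam Kw Kstar)).
  rewrite /= big_nil mul0r !mul0r addr0 add0r addrC subr_ge0.
  by apply: potential_le => //; exact: sqrtr_ge0.
have D0 : 0 <= D by rewrite (le_trans (enorm_ge0 _) (Kdiam Kw Kstar)).
have gw z := grad_bound z Kw.
set C := moment_bound; have C0 : 0 <= C := moment_bound_ge0.
pose g j b := mag_g f T j b w.
pose acc' j b := acc + enorm (g j b) ^+ 2.
pose w' j b := Defs.proj K (w - alpha / Num.sqrt (acc' j b) *: g j b).
have acc'0 j b : 0 <= acc' j b by rewrite addr_ge0 ?sqr_ge0.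
pose gap := F w - F wstar.
have run j b Js s : size b = (2 ^ j)%N ->
    \sum_(u <- mag_iters f K T alpha (j :: Js) (b ++ s) w acc) (F u - F wstar) =
    gap + \sum_(u <- mag_iters f K T alpha Js s (w' j b) (acc' j b)) (F u - F wstar).
  by move=> bj; rewrite /= take_size_cat // drop_size_cat // big_cons.
rewrite expect_runS.
(* With the first block fixed, [adagrad_step] trades [- Psi] at the new point, supplied by the
   induction hypothesis, for [- Psi] at [w] minus the inner product; in expectation the latter
   offsets [gap] up to the bias. *)
apply: (@le_trans _ _ (expect_step P N nu (fun j b =>
  (gap + n%:R * bias_bound - Psi w (Num.sqrt acc)) + (-1 * dot (g j b) (w - wstar) +
    Num.sqrt 2 * D * Num.sqrt (acc' j b + n%:R * C))))).
  apply: ler_expect_step => // j b bj.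
  have nud' := is_distr_next Pstoch b nud.
  have Kw' : K (w' j b) by exact: (proj1 (proj_spec Kclosed Kdiam _ Kw)).
  have := IH _ _ _ nud' Kw' (acc'0 j b).
  have := adagrad_step Kclosed Kconvex Kdiam (g j b) Kstar Kw acc0.
  rewrite -/(acc' j b) -/(w' j b).
  have -> : (fun Js s => \sum_(u <- mag_iters f K T alpha (j :: Js) (b ++ s) w acc)
        (F u - F wstar)) =
      (fun Js s => gap +
        \sum_(u <- mag_iters f K T alpha Js s (w' j b) (acc' j b)) (F u - F wstar)).
    by apply/funext => Js; apply/funext => s; exact: run.
  rewrite (expect_run_addl N Pstoch) //.
  lra.
have natS : n.+1%:R = n%:R + 1 :> R by rewrite natr1.
have n0 : 0 <= n%:R * C by rewrite mulr_ge0.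
set c0 := gap + _ - _.
rewrite expect_stepD (expect_step_cst N Pstoch) // expect_stepD !expect_stepZ /c0.
(* Jensen for a single iteration: the accumulator grows on average by at most [C], which turns [n]
   into [n.+1] under the root. *)
have : expect_step P N nu (fun j b => Num.sqrt (acc' j b + n%:R * C)) <=
    Num.sqrt (acc + n.+1%:R * C).
  apply: le_trans (expect_step_sqrt _ _ _ _) _ => //.
    by move=> j b; rewrite addr_ge0.
  rewrite ler_wsqrtr // natS mulrDl mul1r.
  have -> : expect_step P N nu (fun j b => acc' j b + n%:R * C) =
      expect_step P N nu (fun j b => acc + n%:R * C + enorm (g j b) ^+ 2).
    by apply: eq_expect_step => j b _; rewrite /acc' addrAC.
  rewrite expect_stepD expect_step_cst // -addrA lerD2l lerD2l.
  exact: (expect_sqnorm_mag_g Pstoch mu_stat mix gw T1 LN nud).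
have q0 : 0 <= Num.sqrt 2 * D by rewrite mulr_ge0 ?sqrtr_ge0.
move/(ler_wpM2l q0).
have := mag_step_gap nud Kw; rewrite -/gap natS -/C; lra.
Qed.

End Regret.

(** * From truncated draws to the infinite sum *)

Lemma ler_sum_subset (R : realType) (I : eqType) (s s' : seq I) (h : I -> R) :
  uniq s -> uniq s' -> {subset s <= s'} -> (forall i, i \in s' -> 0 <= h i) ->
  \sum_(i <- s) h i <= \sum_(i <- s') h i.
Proof.
move=> us us' ss' h0.
have p : perm_eq s [seq i <- s' | i \in s].
  apply: uniq_perm; rewrite ?filter_uniq // => i; rewrite mem_filter.
  by case: (boolP (i \in s)) => // /ss' ->.
rewrite (perm_big _ p) /= big_filter big_mkcond /= big_seq [leRHS]big_seq.
by apply: ler_sum => i /h0; case: ifP.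
Qed.

(** An [esum] is a supremum over finite sets of tuples. The entries in such a set are bounded by
    some [N], so its tuples are images of tuples over ['I_N.+1], and nonnegativity of [h'] extends
    the sum to all of these. The majorant may depend on [N]. *)
Lemma esum_tuple_le (R : realType) (n : nat) (S : set (n.-tuple nat))
    (h : seq nat -> R) (c : R) (N0 : nat) :
  (forall N, (N0 <= N)%N ->
     exists2 h' : seq nat -> R, (forall J, S J -> h J <= h' J) /\
       (forall J : n.-tuple nat, 0 <= h' J) &
       \sum_(J : n.-tuple 'I_N.+1) h' [seq val j | j <- J] <= c) ->
  (\esum_(J in S) (h J)%:E <= c%:E)%E.
Proof.
move=> bound; apply: ge_ereal_sup => _ [X [finX XS] <-].
rewrite fsumEFin // lee_fin fsbig_finite //=.
set s := [seq tval J | J <- finmap.enum_fset (fset_set X)].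
pose N := maxn N0 (\max_(x <- s) \max_(j <- x) j)%N.
have [h' [hh' h'0] hc] := bound N (leq_maxl _ _).
apply: le_trans _ hc.
apply: (@le_trans _ _ (\sum_(J <- finmap.enum_fset (fset_set X)) h' J)).
  rewrite big_seq [leRHS]big_seq; apply: ler_sum => J.
  have -> : (J \in finmap.enum_fset (fset_set X)) = (J \in X) by exact: in_fset_set.
  by move=> /set_mem /XS; exact: hh'.
have -> : \sum_(J <- finmap.enum_fset (fset_set X)) h' J = \sum_(x <- s) h' x by rewrite big_map.
set s' := [seq [seq val j | j <- J] | J : n.-tuple 'I_N.+1 <- enum {: n.-tuple 'I_N.+1}].
have -> : \sum_(J : n.-tuple 'I_N.+1) h' [seq val j | j <- J] = \sum_(x <- s') h' x.
  by rewrite big_map big_enum.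
apply: ler_sum_subset.
- by rewrite map_inj_uniq ?finmap.fset_uniq //; exact: val_inj.
- rewrite map_inj_uniq ?enum_uniq // => J J' /(inj_map val_inj) JJ'; exact: val_inj.
- move=> x xs; have /mapP[J _ xJ] := xs.
  have xN j : j \in x -> (j < N.+1)%N.
    move=> jx; rewrite ltnS /N (leq_trans _ (leq_maxr _ _)) //.
    apply: (leq_trans (leq_bigmax_seq (F := id) (P := xpredT) j jx isT)).
    exact: (leq_bigmax_seq (F := fun y : seq nat => (\max_(j <- y) j)%N) (P := xpredT) x xs isT).
  apply/mapP; exists [tuple of map (fun j => inord j : 'I_N.+1) J].
    by rewrite mem_enum.
  rewrite /= -map_comp -[LHS]map_id; rewrite -xJ; apply/eq_in_map => j jx.
  by rewrite /= inordK // xN.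
- move=> _ /mapP[J _ ->].
  by have := h'0 [tuple of map val J].
Qed.

(** * Averaging of the iterates *)

Section Output.
Variables (R : realType) (Omega : finType) (mu : Omega -> R) (d : nat).
Variables (f : 'rV[R]_d -> Omega -> R) (K : set 'rV[R]_d).
Hypothesis Kconvex : convex_set_of K.

(** The mean of [n.+1] points is a convex combination of the first one and the mean of the others.
    Membership in [K] is carried along because convexity is assumed on [K] only. *)
Lemma jensen_mean (F : 'rV[R]_d -> R) (r : seq 'rV[R]_d) : convex_on K F ->
  (0 < size r)%N -> (forall u, u \in r -> K u) ->
  K ((size r)%:R^-1 *: \sum_(u <- r) u) /\
  F ((size r)%:R^-1 *: \sum_(u <- r) u) <= (size r)%:R^-1 * \sum_(u <- r) F u.
Proof.
move=> Fconvex; elim: r => [//|u [|v r] IH] _ rK.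
  by rewrite /= !big_seq1 invr1 scale1r mul1r; split; first exact/rK/mem_head.
have [|w wr|Km Fm] := IH; first by [].
  by apply: rK; rewrite inE wr orbT.
rewrite big_cons [\sum_(i <- _) F i]big_cons.
set n := size (v :: r) in Km Fm *; set S := \sum_(i <- v :: r) i in Km Fm *.
set SF := \sum_(i <- v :: r) F i in Fm *.
have n0 : n%:R != 0 :> R by rewrite pnatr_eq0.
have n1 : n.+1%:R != 0 :> R by rewrite pnatr_eq0.
have nS : n.+1%:R = n%:R + 1 :> R by rewrite natr1.
have -> : size (u :: v :: r) = n.+1 by [].
set l : R := n.+1%:R^-1.
have lE : 1 - l = l * n%:R by rewrite /l nS; field; rewrite -nS.
have l01 : 0 <= l <= 1 by rewrite invr_ge0 ler0n invf_le1 ?ltr0n // ler1n.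
have -> : l *: (u + S) = l *: u + (1 - l) *: (n%:R^-1 *: S).
  by rewrite scalerDr scalerA lE mulfK.
have Ku : K u by apply: rK; exact: mem_head.
split; first exact: Kconvex.
apply: le_trans (Fconvex _ _ _ Ku Km l01) _.
rewrite mulrDr lerD2l.
have -> : l * SF = (1 - l) * (n%:R^-1 * SF) by rewrite mulrA lE mulfK.
by rewrite ler_wpM2l // subr_ge0; case/andP: l01.
Qed.

Lemma size_mag_iters T alpha Js s w acc :
  size (mag_iters f K T alpha Js s w acc) = size Js.
Proof. by elim: Js s w acc => [//|j Js IH] s w acc /=; rewrite IH. Qed.

Lemma mag_iters_in T alpha Js s w acc (D : R) :
  closed K -> (forall x y, K x -> K y -> enorm (x - y) <= D) -> K w ->
  forall u, u \in mag_iters f K T alpha Js s w acc -> K u.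
Proof.
move=> Kclosed Kdiam; elim: Js s w acc => [//|j Js IH] s w acc Kw u /=.
rewrite inE => /predU1P[-> //|]; apply: IH.
exact: (proj1 (proj_spec Kclosed Kdiam _ Kw)).
Qed.

End Output.

(** * Logarithms and explicit rates *)

Lemma trunc_log2_le_ln (R : realType) (T : nat) : (1 <= T)%N ->
  (trunc_log 2 T)%:R <= 2 * ln T%:R :> R.
Proof.
move=> T1; have ln2 : 2^-1 <= ln 2 :> R.
  have : ln (1 + - 2^-1) <= - 2^-1 :> R by apply: le_ln1Dx; lra.
  have -> : 1 + - 2^-1 = 2^-1 :> R by field.
  by rewrite lnV ?posrE // lerN2.
have : ln (2 ^+ trunc_log 2 T) <= ln T%:R :> R.
  by rewrite ler_ln ?posrE ?exprn_gt0 ?ltr0n // -natrX ler_nat trunc_logP.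
rewrite lnXn // -(mulr_natl (ln 2)).
by have := ler_wpM2l (ler0n R (trunc_log 2 T)) ln2; lra.
Qed.

Lemma sqrt_le (R : realType) (a b : R) : 0 <= b -> a <= b ^+ 2 -> Num.sqrt a <= b.
Proof. by move=> b0 ab; rewrite -[leRHS]ger0_norm // -sqrtr_sqr ler_wsqrtr. Qed.

Section Rate.
Variables (R : realType) (G D : R) (tau T : nat).
Hypotheses (G0 : 0 <= G) (D0 : 0 <= D) (T1 : (1 <= T)%N).
Local Notation X := (Num.sqrt ((maxn tau 1)%:R / T%:R : R)).
Local Notation L := (trunc_log 2 T).

Lemma sqr_rate : X ^+ 2 = (maxn tau 1)%:R / T%:R.
Proof. by rewrite sqr_sqrtr // divr_ge0. Qed.

(** [T < 2 ^ L.+1] bounds [kappa / 2 ^+ L] by [72 * G ^+ 2 * X ^+ 2], and 72 is rounded up to the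
    square 81. *)
Lemma bias_rate : bias_bound tau G D T <= 9 * G * D * X.
Proof.
have Tp : 0 < T%:R :> R by rewrite ltr0n.
have -> : 9 * G * D * X = D * (9 * G * X) by ring.
apply: ler_wpM2l => //; apply: sqrt_le; first by rewrite !mulr_ge0 ?sqrtr_ge0.
have -> : (9 * G * X) ^+ 2 = 81 * G ^+ 2 * X ^+ 2 by ring.
rewrite sqr_rate; set e := 2 ^+ L; have e0 : 0 < e by rewrite exprn_gt0.
have eT : 2^-1 <= e / T%:R.
  rewrite ler_pdivlMr // ler_pdivrMl // -exprS -natrX ler_nat ltnW //.
  by case/andP: (trunc_log_bounds (isT : (1 < 2)%N) T1).
rewrite ler_pdivrMr //.
have a0 : 0 <= G ^+ 2 * (maxn tau 1)%:R by rewrite mulr_ge0 ?sqr_ge0.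
have -> : 81 * G ^+ 2 * ((maxn tau 1)%:R / T%:R) * e =
  81 * (G ^+ 2 * (maxn tau 1)%:R * (e / T%:R)) by ring.
by have := ler_wpM2l a0 eT; lra.
Qed.

(** After squaring, [4 + 864 * L] is to be dominated by [81 * (1 + 12 * L) ^ 2]; the generous
    right-hand side avoids a square root of [L]. *)
Lemma moment_rate :
  Num.sqrt 2 * D * Num.sqrt (T%:R * moment_bound tau G T) <=
  T%:R * (9 * G * D * X * (1 + 12 * L%:R)).
Proof.
have Tp : 0 < T%:R :> R by rewrite ltr0n.
have L0 : 0 <= L%:R :> R by [].
have -> : T%:R * (9 * G * D * X * (1 + 12 * L%:R)) =
  D * (T%:R * 9 * G * X * (1 + 12 * L%:R)) by ring.
rewrite mulrAC mulrC; apply: ler_wpM2l => //.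
rewrite -sqrtrM //; apply: sqrt_le.
  by rewrite !mulr_ge0 ?sqrtr_ge0 // addr_ge0 // mulr_ge0.
have -> : (T%:R * 9 * G * X * (1 + 12 * L%:R)) ^+ 2 =
  T%:R ^+ 2 * 81 * G ^+ 2 * X ^+ 2 * (1 + 12 * L%:R) ^+ 2 by ring.
rewrite sqr_rate /moment_bound.
have -> : T%:R ^+ 2 * 81 * G ^+ 2 * ((maxn tau 1)%:R / T%:R) * (1 + 12 * L%:R) ^+ 2 =
  T%:R * (81 * (G ^+ 2 * (maxn tau 1)%:R) * (1 + 12 * L%:R) ^+ 2).
  by field; rewrite gt_eqF.
rewrite mulrCA; apply: ler_wpM2l; first exact: ltW.
have a0 : 0 <= G ^+ 2 * (maxn tau 1)%:R by rewrite mulr_ge0 ?sqr_ge0.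
have aG : G ^+ 2 <= G ^+ 2 * (maxn tau 1)%:R.
  by rewrite ler_peMr ?sqr_ge0 // ler1n leq_maxr.
have aL := mulr_ge0 a0 L0; have aLL := mulr_ge0 aL L0.
by move: a0 aG aL aLL; move: (G ^+ 2) (maxn tau 1)%:R L%:R => g t l; lra.
Qed.

End Rate.

Theorem theorem3p3 :
  exists c k : nat,
  forall (R : realType) (Omega : finType) (P : Omega -> Omega -> R)
    (nu mu : Omega -> R) (tau : nat)
    (d : nat) (K : set 'rV[R]_d) (f : 'rV[R]_d -> Omega -> R)
    (G D : R) (wstar w1 : 'rV[R]_d) (T : nat),
  ergodic P -> is_distr nu -> stationary P mu -> is_tau_mix P mu tau ->
  closed K -> convex_set_of K ->
  (forall z w, differentiable (f^~ z) w) ->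
  convex_on K (popF f mu) ->
  (forall w z, K w -> enorm (grad (f^~ z) w) <= G) ->
  (forall x y, K x -> K y -> enorm (x - y) <= D) ->
  K wstar -> (forall w, K w -> popF f mu wstar <= popF f mu w) ->
  K w1 -> (1 <= T)%N ->
  (mag_expected_gap f K T (D / Num.sqrt 2) w1 nu mu P wstar <=
     (c%:R * G * D * Num.sqrt ((maxn tau 1)%:R / T%:R)
      * (1 + ln (T%:R) + ln ((maxn tau 1)%:R)) ^+ k)%:E)%E.
Proof.
(* The two rates add up to the factor [18 + 108 * L], and [L <= 2 * ln T] makes it at most
   [216 * (1 + ln T)]: one logarithm suffices. *)
exists 216%N, 1%N => R Omega P nu mu tau d K f G D wstar w1 T [Pstoch _] nud mu_stat [mix _]
  Kclosed Kconvex fdiff Fconvex grad_bound Kdiam Kstar wmin Kw1 T1.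
have D0 : 0 <= D by rewrite (le_trans (enorm_ge0 _) (Kdiam _ _ Kstar Kstar)).
have G0 : 0 <= G.
  have [z _|none] := pickP (fun=> true : bool) (T := Omega).
    by rewrite (le_trans (enorm_ge0 _) (grad_bound _ z Kstar)).
  by case: nud => _; rewrite big_pred0 // => /eqP; rewrite eq_sym oner_eq0.
set X := Num.sqrt (_ / _); have X0 : 0 <= X by exact: sqrtr_ge0.
have Tp : 0 < T%:R :> R by rewrite ltr0n.
set F := popF f mu; set alpha := D / Num.sqrt 2.
pose gap Js s := F (mag_output f K T alpha Js s w1) - F wstar.
have iters_in Js s u : u \in mag_iters f K T alpha Js s w1 0 -> K u.
  by apply: (mag_iters_in Kclosed Kdiam Kw1).
have output_in Js s : size Js = T -> K (mag_output f K T alpha Js s w1) /\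
    F (mag_output f K T alpha Js s w1) <=
    T%:R^-1 * \sum_(u <- mag_iters f K T alpha Js s w1 0) F u.
  move=> JsT; have := @jensen_mean _ _ _ Kconvex F (mag_iters f K T alpha Js s w1 0) Fconvex.
  by rewrite size_mag_iters JsT; apply; [exact: T1 | exact: iters_in].
have gap_ge0 Js s : size Js = T -> 0 <= gap Js s.
  by move=> JsT; rewrite subr_ge0 wmin //; case: (output_in Js s JsT).
have gap_le Js s : size Js = T -> gap Js s <=
    T%:R^-1 * \sum_(u <- mag_iters f K T alpha Js s w1 0) (F u - F wstar).
  move=> JsT; rewrite sumrB big_const_seq count_predT size_mag_iters JsT iter_addr_0.
  rewrite mulrBr -(mulr_natl (F wstar)) mulKf ?gt_eqF // lerB //.
  by case: (output_in Js s JsT).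
pose h Js := (\prod_(j <- Js) (2 ^+ j)^-1) *
  \sum_(p : (nsamples Js).-tuple Omega) path_prob nu P p * gap Js p.
rewrite /mag_expected_gap.
apply: (@esum_tuple_le R T _ h _ (trunc_log 2 T)) => N LN.
pose h' Js := (\prod_(j <- Js) level_prob R N j) *
  expect_chain P nu (nsamples Js) (gap Js).
exists h'.
  split=> J.
    (* When all draws are at least 1, [level_prob] is exactly [2 ^ - j], so [h] and [h'] agree; the
       tuples with a zero draw only add nonnegative terms. *)
    move=> /allP J1; rewrite /h /h' sum_path_prob le_eqVlt; apply/orP; left; apply/eqP.
    congr (_ * _); rewrite big_seq [RHS]big_seq; apply: eq_bigr => j /J1.
    by rewrite /level_prob; case: j.
  rewrite mulr_ge0 ?prodr_ge0 //.
    by move=> j _; exact: level_prob_ge0.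
  rewrite -(expect_chain_cst Pstoch (nsamples J) 0 nud); apply: ler_expect_chain => // b _.
  by rewrite gap_ge0 // size_tuple.
have -> : \sum_(J : T.-tuple 'I_N.+1) h' [seq val j | j <- J] = expect_run P N T nu gap.
  by rewrite -sum_run_prob; apply: eq_bigr => J _; rewrite /h' big_map.
apply: (@le_trans _ _ (T%:R^-1 * expect_run P N T nu (fun Js s =>
    \sum_(u <- mag_iters f K T alpha Js s w1 0) (F u - F wstar)))).
  by rewrite -expect_runZ; apply: ler_expect_run => // Js s; exact: gap_le.
have := expected_regret Pstoch mu_stat mix Kclosed Kconvex Kdiam fdiff Fconvex grad_bound
  Kstar T1 LN T nud Kw1 (lexx 0).
(* The run starts with accumulator 0, so the initial potential is zero. *)
rewrite sqrtr0 {1}/potential mulr0 subr0 add0r -/F -/alpha => regret.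
have bias := bias_rate tau G0 D0 T1; have moment := moment_rate tau G0 D0 T1.
rewrite -/X in bias moment.
rewrite mulrC ler_pdivrMr // expr1.
have lnT := trunc_log2_le_ln R T1.
have lntau : 0 <= ln (maxn tau 1)%:R :> R by rewrite ln_ge0 // ler1n leq_maxr.
have lnT0 : 0 <= ln T%:R :> R by rewrite ln_ge0 // ler1n.
have GDX : 0 <= T%:R * (G * D * X) by rewrite !mulr_ge0 ?ler0n.
apply: (le_trans regret).
have biasT := ler_wpM2l (ltW Tp) bias.
apply: le_trans (lerD biasT moment) _.
have -> : T%:R * (9 * G * D * X) + T%:R * (9 * G * D * X * (1 + 12 * (trunc_log 2 T)%:R)) =
  T%:R * (G * D * X) * (18 + 108 * (trunc_log 2 T)%:R) by ring.
have -> : 216%:R * G * D * X * (1 + ln T%:R + ln (maxn tau 1)%:R) * T%:R =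
  T%:R * (G * D * X) * (216%:R * (1 + ln T%:R + ln (maxn tau 1)%:R)) by ring.
by apply: ler_wpM2l => //; lra.
Qed.
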